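(* (Banach lattice) (a) $\mathcal B_c(\overline{\mathbb R}^2)$ is a Banach lattice (under the pointwise order and $\lVert\cdot\rVert_\infty$). (b) For $f_1,f_2\in\mathcal A_c(\mathbb R^2)$ with respective primitives $F_1,F_2\in\mathcal B_c(\overline{\mathbb R}^2)$, define $f_1\preceq f_2$ if $F_1\le F_2$ in $\mathcal B_c(\overline{\mathbb R}^2)$. Then $\mathcal A_c(\mathbb R^2)$ is a Banach lattice isomorphic to $\mathcal B_c(\overline{\mathbb R}^2)$. (c) $\mathcal B_c(\overline{\mathbb R}^2)$ and $\mathcal A_c(\mathbb R^2)$ do not have an order unit. (d) Let $F,F_1,F_2\in\mathcal B_c(\overline{\mathbb R}^2)$. Then $\partial_{12}(F_1\vee F_2)=(\partial_{12}F_1)\vee(\partial_{12}F_2)$, $\partial_{12}(F_1\wedge F_2)=(\partial_{12}F_1)\wedge(\partial_{12}F_2)$, $|\partial_{12}F|=\partial_{12}|F|$, $\partial_{12}(F^+)=(\partial_{12}F)^+$, and $\partial_{12}(F^-)=(\partial_{12}F)^-$. (e) If $f\in\mathcal A_c(\mathbb R^2)$ with primitive $F\in\mathcal B_c(\overline{\mathbb R}^2)$ then $|f|\in\mathcal A_c(\mathbb R^2)$ with primitive $|F|\in\mathcal B_c(\overline{\mathbb R}^2)$ and $\int_{-\infty}^x\int_{-\infty}^y|f|=\left|\int_{-\infty}^x\int_{-\infty}^yf\right|$ for all $(x,y)\in\overline{\mathbb R}^2$. And $\lVert|f|\rVert=\lVert f\rVert$, $\lVert f^\pm\rVert\le\lVert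 f\rVert$. (f) If $f\in\mathcal A_c(\mathbb R^2)$ with primitive $F$ then $f^\pm\in\mathcal A_c(\mathbb R^2)$ with respective primitives $F^\pm\in\mathcal B_c(\overline{\mathbb R}^2)$. Jordan decomposition: $f=f^+-f^-$. And $\int_{-\infty}^\infty\int_{-\infty}^\infty fg=\int_{-\infty}^\infty\int_{-\infty}^\infty f^+g-\int_{-\infty}^\infty\int_{-\infty}^\infty f^-g$ for every $g\in\mathcal{HKBV}(\overline{\mathbb R}^2)$. (g) $\mathcal A_c(\mathbb R^2)$ is distributive: $f_1\wedge(f_2\vee f_3)=(f_1\wedge f_2)\vee(f_1\wedge f_3)$ and $f_1\vee(f_2\wedge f_3)=(f_1\vee f_2)\wedge(f_1\vee f_3)$ for all $f_1,f_2,f_3\in\mathcal A_c(\mathbb R^2)$. (h) $\mathcal A_c(\mathbb R^2)$ is modular: for all $f_1,f_2\in\mathcal A_c(\mathbb R^2)$, if $f_1\preceq f_2$ then $f_1\vee(f_2\wedge f_3)=f_2\wedge(f_1\vee f_3)$ for all $f_3\in\mathcal A_c(\mathbb R^2)$. (i) Let $F_1$ and $F_2$ be continuous functions on $\overline{\mathbb R}^2$. Then $\partial_{12}F_1\preceq\partial_{12}F_2$ if and only if $$F_1(-\infty,-\infty)+F_1(x,y)-F_1(-\infty,y)-F_1(x,-\infty)\le F_2(-\infty,-\infty)+F_2(x,y)-F_2(-\infty,y)-F_2(x,-\infty)$$ for all $(x,y)\in\overline{\mathbb R}^2$.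
   Context: $\overline{\mathbb R}=[-\infty,\infty]$ is the two-point compactification of $\mathbb R$, and $\overline{\mathbb R}^2$ carries the product topology. $\mathcal B_c(\overline{\mathbb R}^2)$ is the Banach space (uniform norm) of continuous $F:\overline{\mathbb R}^2\to\mathbb R$ with $F(-\infty,s)=F(s,-\infty)=0$ for all $s\in\overline{\mathbb R}$, ordered pointwise: $F_1\le F_2$ iff $F_1(x,y)\le F_2(x,y)$ for all $(x,y)\in\overline{\mathbb R}^2$. $\partial_{12}=\partial_1\partial_2$ is the distributional derivative on $\mathbb R^2$, and $\mathcal A_c(\mathbb R^2)=\{\partial_{12}F\mid F\in\mathcal B_c(\overline{\mathbb R}^2)\}\subset\mathcal D'(\mathbb R^2)$; the primitive $F\in\mathcal B_c(\overline{\mathbb R}^2)$ of $f=\partial_{12}F$ is unique and the Alexiewicz norm is $\lVert f\rVert=\lVert F\rVert_\infty$. For $G$ continuous on $\overline{\mathbb R}^2$, $\partial_{12}G\in\mathcal A_c(\mathbb R^2)$. $\int_{-\infty}^x\int_{-\infty}^yf=F(x,y)$. A Banach space $S$ with partial order $\preceq$ is a Banach lattice if for all $x,y\in S$: the join $x\vee y=\sup\{x,y\}$ and the meet $x\wedge y=\inf\{x,y\}$ exist in $S$; $x\preceq y$ implies $x+z\preceq y+z$ for all $z\in S$; $x\preceq y$ implies $kx\preceq ky$ for real $k\ge0$; $|x|\preceq|y|$ implies $\lVert x\rVert_S\le\lVert y\rVert_S$. Here $|x|=x\vee(-x)$, $x^+=x\vee0$, $x^-=(-x)\vee0$. An order unit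 is an element $e\succeq0$ such that for each $x\in S$ there is $\lambda>0$ with $|x|\preceq\lambda e$. In (b) the isomorphism is given by $\partial_{12}$. Hardy--Krause variation: a division of $\overline{\mathbb R}^2$ is a finite collection of closed intervals with union $\overline{\mathbb R}^2$ whose pairwise intersections have planar Lebesgue measure zero. For $g:\overline{\mathbb R}^2\to\mathbb R$, $V_{12}g=\sup\sum_i|g(a_i,c_i)+g(b_i,d_i)-g(a_i,d_i)-g(b_i,c_i)|$ over all divisions $\{[a_i,b_i]\times[c_i,d_i]\}$ of $\overline{\mathbb R}^2$; $V_1g(\cdot,y_0)$ and $V_2g(x_0,\cdot)$ are the one-variable total variations over $\overline{\mathbb R}$ of $x\mapsto g(x,y_0)$ and $y\mapsto g(x_0,y)$. $\mathcal{HKBV}(\overline{\mathbb R}^2)$ is the set of $g$ with $V_{12}g<\infty$ and, for some $x_0,y_0\in\overline{\mathbb R}$, $V_1g(\cdot,y_0)<\infty$ and $V_2g(x_0,\cdot)<\infty$. Stieltjes integrals are Henstock--Stieltjes integrals: a gauge $\gamma$ assigns to each point an open set containing it (contained in $\mathbb R^2$ for points of $\mathbb R^2$); a tagged division $\{[a_i,b_i]\times[c_i,d_i],(x_i,y_i)\}$ (tag in its interval) is $\gamma$-fine if each interval is contained in $\gamma$ of its tag; $\iint F\,d_{12}g=A$ means for every $\epsilon>0$ there is a gauge $\gamma$ such that $|\sum_iF(x_i,y_i)[g(a_i,c_i)+g(b_i,d_i)-g(a_i,d_i)-g(b_i,c_i)]-A|<\epsilon$ for each $\gamma$-fine tagged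 division of the interval of integration. $d_1$ and $d_2$ denote the analogous one-variable integrals with respect to the first, resp. second, variable. The integral of the product $fg$ is defined by integration by parts: for $f\in\mathcal A_c(\mathbb R^2)$ with primitive $F$ and $g\in\mathcal{HKBV}(\overline{\mathbb R}^2)$, $\int_{-\infty}^\infty\int_{-\infty}^\infty fg:=F(\infty,\infty)g(\infty,\infty)-\int_{-\infty}^\infty F(s,\infty)\,d_1g(s,\infty)-\int_{-\infty}^\infty F(\infty,t)\,d_2g(\infty,t)+\int_{-\infty}^\infty\int_{-\infty}^\infty F\,d_{12}g$. *)

(* Defs.v *)
From HB Require Import structures.
From mathcomp Require Import all_boot all_order all_algebra.
From mathcomp Require Import all_classical all_reals all_analysis.

Set Implicit Arguments.
Unset Strict Implicit.
Unset Printing Implicit Defensive.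

Import Order.TTheory GRing.Theory Num.Theory.
Import numFieldNormedType.Exports.

Local Open Scope classical_set_scope.
Local Open Scope ring_scope.

(** The spaces [B_c] and [A_c] live inside the vector spaces of all functions
    on [\bar R * \bar R] and of all functionals on test functions; a space with
    order and norm is therefore a subset of an ambient [lmodType].  The order
    and the norm are only meaningful on [elt]. *)
Record onspace (R : realType) (V : lmodType R) := ONSpace {
  elt : set V;
  ole : V -> V -> Prop;
  onorm : V -> R
}.

Section BanachLattice.
Variables (R : realType) (V : lmodType R) (L : onspace V).

Definition is_subspace : Prop :=
  elt L 0 /\
  forall (a : R) (x y : V), elt L x -> elt L y -> elt L (a *: x + y).

Definition is_norm : Prop :=
  [/\ forall x, elt L x -> 0 <= onorm L x,
      forall x, elt L x -> onorm L x = 0 -> x = 0,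
      forall (a : R) x, elt L x -> onorm L (a *: x) = `|a| * onorm L x &
      forall x y, elt L x -> elt L y ->
        onorm L (x + y) <= onorm L x + onorm L y].

Definition is_complete : Prop :=
  forall u : nat -> V, (forall n, elt L (u n)) ->
    (forall e : R, 0 < e -> exists N : nat, forall m n : nat,
       (N <= m)%N -> (N <= n)%N -> onorm L (u m - u n) < e) ->
    exists2 x, elt L x & (fun n => onorm L (u n - x)) @ \oo --> (0 : R).

Definition is_banach : Prop := [/\ is_subspace, is_norm & is_complete].

Definition is_partial_order : Prop :=
  [/\ forall x, elt L x -> ole L x x,
      forall x y, elt L x -> elt L y -> ole L x y -> ole L y x -> x = y &
      forall x y z, elt L x -> elt L y -> elt L z ->
        ole L x y -> ole L y z -> ole L x z].

Definition is_join (x y z : V) : Prop :=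
  [/\ elt L z, ole L x z, ole L y z &
      forall w, elt L w -> ole L x w -> ole L y w -> ole L z w].

Definition is_meet (x y z : V) : Prop :=
  [/\ elt L z, ole L z x, ole L z y &
      forall w, elt L w -> ole L w x -> ole L w y -> ole L w z].

(** Chosen by [xget], with junk value [0] when no join (meet) exists. *)
Definition join (x y : V) : V := xget 0 [set z | is_join x y z].
Definition meet (x y : V) : V := xget 0 [set z | is_meet x y z].

Definition labs (x : V) : V := join x (- x).
Definition lpos (x : V) : V := join x 0.
Definition lneg (x : V) : V := join (- x) 0.

Definition is_banach_lattice : Prop :=
  is_banach /\ is_partial_order /\
  [/\ forall x y, elt L x -> elt L y ->
        (exists z, is_join x y z) /\ (exists z, is_meet x y z),
      forall x y z, elt L x -> elt L y -> elt L z ->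
        ole L x y -> ole L (x + z) (y + z),
      forall x y (k : R), elt L x -> elt L y -> 0 <= k ->
        ole L x y -> ole L (k *: x) (k *: y) &
      forall x y, elt L x -> elt L y ->
        ole L (labs x) (labs y) -> onorm L x <= onorm L y].

Definition is_order_unit (e : V) : Prop :=
  [/\ elt L e, ole L 0 e &
      forall x, elt L x ->
        exists2 lambda : R, 0 < lambda & ole L (labs x) (lambda *: e)].

End BanachLattice.

Definition is_banach_lattice_iso (R : realType) (V W : lmodType R)
    (L : onspace V) (M : onspace W) (T : V -> W) : Prop :=
  [/\ set_bij (elt L) (elt M) T,
      forall (a : R) x y, elt L x -> elt L y ->
        T (a *: x + y) = a *: T x + T y,
      forall x y, elt L x -> elt L y -> ole L x y <-> ole M (T x) (T y),
      forall x y, elt L x -> elt L y ->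
        T (join L x y) = join M (T x) (T y) /\
        T (meet L x y) = meet M (T x) (T y) &
      forall x, elt L x -> onorm M (T x) = onorm L x].

Section Bc.
Variable R : realType.

Definition Bc_set : set (\bar R * \bar R -> R) :=
  [set F | continuous F /\
           forall s : \bar R, F (-oo%E, s) = 0 /\ F (s, -oo%E) = 0].

Definition Bc_le (F G : \bar R * \bar R -> R) : Prop := forall z, F z <= G z.

Definition supnorm (F : \bar R * \bar R -> R) : R :=
  sup (range (fun z => `|F z|)).

Definition Bc : onspace (\bar R * \bar R -> R) := ONSpace Bc_set Bc_le supnorm.

End Bc.

Section TestFunctions.
Variable R : realType.
Implicit Types (p : R * R -> R) (s : seq bool) (b : bool).

(** Partial derivatives: [false] is the first variable, [true] the second. *)
Definition slice b p (z : R * R) : R -> R :=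
  if b then fun t => p (z.1, t) else fun t => p (t, z.2).
Definition coordinate b (z : R * R) : R := if b then z.2 else z.1.
Definition partial b p (z : R * R) : R := (slice b p z)^`()%classic (coordinate b z).

(** [partials [:: b1; ...; bk] p] is [partial b1 (... (partial bk p))]; the
    words in [b]'s cover all mixed partial derivatives, in any order. *)
Definition partials s p : R * R -> R := foldr partial p s.

Definition smooth p : Prop :=
  forall s, continuous (partials s p) /\
    forall b z, derivable (slice b (partials s p) z) (coordinate b z) 1.

Definition support p : set (R * R) := closure [set z | p z != 0].

Definition testfun_pred : {pred R * R -> R} :=
  mem [set p | smooth p /\ compact (support p)].

Lemma testfun_predP p :
  reflect (smooth p /\ compact (support p)) (p \in testfun_pred).
Proof. by apply: (iffP idP) => [/set_mem|/mem_set]. Qed.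

Lemma sliceD b p q z : slice b (p + q) z = slice b p z + slice b q z.
Proof. by case: b. Qed.

Lemma sliceZ b (a : R) p z : slice b (a *: p) z = a *: slice b p z.
Proof. by case: b. Qed.

Lemma partials_lin s (a : R) p q : smooth p -> smooth q ->
  partials s (a *: p + q) = a *: partials s p + partials s q.
Proof.
move=> sp sq; elim: s => //= b s ->; apply/funext => z.
have dp := (sp s).2 b z; have dq := (sq s).2 b z.
rewrite /partial sliceD sliceZ derive1E.
rewrite deriveD; [|exact: derivableZ|exact: dq].
by rewrite deriveZ // !fctE -!derive1E.
Qed.

Lemma smooth_lin (a : R) p q : smooth p -> smooth q -> smooth (a *: p + q).
Proof.
move=> sp sq s; rewrite partials_lin//; split.
  move=> z; apply: continuousD; last exact: (sq s).1.
  by apply: cvgZl_tmp; exact: (sp s).1.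
move=> b z; rewrite sliceD sliceZ.
by apply: derivableD; [apply: derivableZ; exact: (sp s).2|exact: (sq s).2].
Qed.

Lemma smooth_partial b p : smooth p -> smooth (partial b p).
Proof.
move=> sp s; have := sp (rcons s b).
by rewrite /partials -cats1 foldr_cat.
Qed.

Lemma partial0 b : partial b 0 = 0.
Proof.
apply/funext => z; rewrite /partial.
have -> : slice b 0 z = cst 0 by case: b.
by rewrite derive1_cst.
Qed.

Lemma smooth0 : smooth 0.
Proof.
move=> s; have -> : partials s 0 = 0 by elim: s => //= b s ->; exact: partial0.
split=> [z|b z]; first exact: cst_continuous.
have -> : slice b 0 z = cst 0 by case: b.
exact: derivable_cst.
Qed.

Lemma compact_support_lin (a : R) p q :
  compact (support p) -> compact (support q) ->
  compact (support (a *: p + q)).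
Proof.
move=> cp cq; apply: (subclosed_compact _ (compactU cp cq)).
  exact: closed_closure.
rewrite /support -closureU; apply: closureS => z /= h.
apply: contrapT => /not_orP[/negP/negPn/eqP pz /negP/negPn/eqP qz].
by move: h; rewrite !fctE pz qz scaler0 addr0 eqxx.
Qed.

Lemma partial_out b p z : ~ support p z -> partial b p z = 0.
Proof.
move=> Nz; have oNs : open (~` support p) by exact/closed_openC/closed_closure.
have nz : nbhs z (~` support p) by exact: open_nbhs_nbhs.
have p0 y : (~` support p) y -> p y = 0.
  by move=> Ny; apply: contrapT => /eqP py; apply: Ny; exact: subset_closure.
rewrite /partial derive1E.
rewrite (@near_eq_derive _ _ _ _ (cst 0)); first by rewrite derive_cst.
have [[A B] /= [nA nB] AB] := nz.
case: b => /=; [move: nB|move: nA]; apply: filterS => t ht;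
  by apply: p0; apply: AB; split=> //=; exact: nbhs_singleton.
Qed.

Lemma compact_support_partial b p :
  compact (support p) -> compact (support (partial b p)).
Proof.
move=> cp; apply: (subclosed_compact _ cp); first exact: closed_closure.
have <- : closure (support p) = support p.
  by apply/esym/closure_id; exact: closed_closure.
apply: closureS => z /= h; apply: contrapT => /partial_out pz.
by move: h; rewrite pz eqxx.
Qed.

Lemma testfun_submod : GRing.submod_closed testfun_pred.
Proof.
split=> [|a p q].
  apply/testfun_predP; split; first exact: smooth0.
  have -> : support 0 = set0; last exact: compact0.
  rewrite /support (_ : [set _ | _] = set0) ?closure0//.
  by rewrite -subset0 => z /=; rewrite eqxx.
move=> /testfun_predP[sp cp] /testfun_predP[sq cq]; apply/testfun_predP.
by split; [exact: smooth_lin|exact: compact_support_lin].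
Qed.

HB.instance Definition _ :=
  GRing.isSubmodClosed.Build R (R * R -> R) testfun_pred testfun_submod.

End TestFunctions.

Record testfun (R : realType) := TestFun {
  testfun_fun :> R * R -> R;
  testfunP : testfun_fun \in @testfun_pred R
}.

Section Distributions.
Variable R : realType.

HB.instance Definition _ := [isSub for @testfun_fun R].
HB.instance Definition _ := [Choice of testfun R by <:].
HB.instance Definition _ := [SubChoice_isSubLmodule of testfun R by <:].

Lemma test_partial_subproof b (phi : testfun R) :
  partial b phi \in @testfun_pred R.
Proof.
have /testfun_predP[sp cp] := testfunP phi; apply/testfun_predP.
by split; [exact: smooth_partial|exact: compact_support_partial].
Qed.

Definition test_partial b (phi : testfun R) : testfun R :=
  TestFun (test_partial_subproof b phi).

(** Convergence of test functions: the supports lie in a common compact set and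
    every partial derivative converges uniformly. *)
Definition testfun_cvg (u : nat -> testfun R) (phi : testfun R) : Prop :=
  (exists2 K : set (R * R), compact K & forall n, support (u n) `<=` K) /\
  forall (s : seq bool) (e : R), 0 < e ->
    \forall n \near \oo, forall z,
      `|partials s (u n) z - partials s phi z| < e.

Definition is_distribution (T : testfun R -> R) : Prop :=
  scalar T /\
  forall u phi, testfun_cvg u phi -> (fun n => T (u n)) @ \oo --> T phi.

Definition dist_partial b (T : testfun R -> R) : testfun R -> R :=
  fun phi => - T (test_partial b phi).

Definition dist_of_fun (F : \bar R * \bar R -> R) : testfun R -> R :=
  fun phi => \int[(lebesgue_measure \x lebesgue_measure)%E]_z
    (F (z.1%:E, z.2%:E) * phi z).

Definition d12 (F : \bar R * \bar R -> R) : testfun R -> R :=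
  dist_partial false (dist_partial true (dist_of_fun F)).

Definition Ac_set : set (testfun R -> R) :=
  [set f | is_distribution f /\ exists2 F, Bc_set F & f = d12 F].

Definition is_primitive (F : \bar R * \bar R -> R) (f : testfun R -> R) : Prop :=
  Bc_set F /\ d12 F = f.

Definition primitive (f : testfun R -> R) : \bar R * \bar R -> R :=
  xget 0 [set F | is_primitive F f].

Definition Ac_int (f : testfun R -> R) (x y : \bar R) : R := primitive f (x, y).

Definition Ac_le (f g : testfun R -> R) : Prop :=
  exists F G, [/\ is_primitive F f, is_primitive G g & Bc_le F G].

Definition alexiewicz (f : testfun R -> R) : R := supnorm (primitive f).

Definition Ac : onspace (testfun R -> R) := ONSpace Ac_set Ac_le alexiewicz.

End Distributions.

Section Divisions.
Variable R : realType.

Definition itv1 (I : \bar R * \bar R) : set (\bar R) := `[I.1, I.2]%classic.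

Definition division1 (n : nat) (I : 'I_n -> \bar R * \bar R) : Prop :=
  [/\ forall i, ((I i).1 < (I i).2)%E,
      \bigcup_i itv1 (I i) = setT &
      forall i j, i != j ->
        lebesgue_measure [set x : R | itv1 (I i) x%:E /\ itv1 (I j) x%:E]
          = 0%E].

Definition incr1 (g : \bar R -> R) (I : \bar R * \bar R) : R := g I.2 - g I.1.

Definition var1 (g : \bar R -> R) : \bar R :=
  ereal_sup [set v | exists n (I : 'I_n -> \bar R * \bar R),
    division1 I /\ v = (\sum_(i < n) `|incr1 g (I i)|)%:E].

(** The pair of pairs [((a, b), (c, d))] stands for [[a, b] x [c, d]]. *)
Definition rect : Type := ((\bar R * \bar R) * (\bar R * \bar R))%type.

Definition itv2 (I : rect) : set (\bar R * \bar R) := itv1 I.1 `*` itv1 I.2.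

Definition division2 (n : nat) (I : 'I_n -> rect) : Prop :=
  [/\ forall i, ((I i).1.1 < (I i).1.2)%E /\ ((I i).2.1 < (I i).2.2)%E,
      \bigcup_i itv2 (I i) = setT &
      forall i j, i != j ->
        (lebesgue_measure \x lebesgue_measure)%E
          [set z : R * R | itv2 (I i) (z.1%:E, z.2%:E) /\
                           itv2 (I j) (z.1%:E, z.2%:E)] = 0%E].

Definition incr2 (g : \bar R * \bar R -> R) (I : rect) : R :=
  let: ((a, b), (c, d)) := I in g (a, c) + g (b, d) - g (a, d) - g (b, c).

Definition var12 (g : \bar R * \bar R -> R) : \bar R :=
  ereal_sup [set v | exists n (I : 'I_n -> rect),
    division2 I /\ v = (\sum_(i < n) `|incr2 g (I i)|)%:E].

Definition HKBV : set (\bar R * \bar R -> R) :=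
  [set g | (var12 g < +oo)%E /\
     exists x0 y0, (var1 (fun x => g (x, y0)) < +oo)%E /\
                   (var1 (fun y => g (x0, y)) < +oo)%E].

Definition gauge1 (gam : \bar R -> set (\bar R)) : Prop :=
  (forall x, open (gam x) /\ gam x x) /\
  forall x : R, gam x%:E `<=` range (@EFin R).

Definition gauge2 (gam : \bar R * \bar R -> set (\bar R * \bar R)) : Prop :=
  (forall z, open (gam z) /\ gam z z) /\
  forall x y : R, gam (x%:E, y%:E) `<=` range (@EFin R) `*` range (@EFin R).

Definition fine1 (gam : \bar R -> set (\bar R)) (n : nat)
    (I : 'I_n -> \bar R * \bar R) (t : 'I_n -> \bar R) : Prop :=
  division1 I /\ forall i, itv1 (I i) (t i) /\ itv1 (I i) `<=` gam (t i).

Definition fine2 (gam : \bar R * \bar R -> set (\bar R * \bar R)) (n : nat)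
    (I : 'I_n -> rect) (t : 'I_n -> \bar R * \bar R) : Prop :=
  division2 I /\ forall i, itv2 (I i) (t i) /\ itv2 (I i) `<=` gam (t i).

Definition is_hs1 (F g : \bar R -> R) (A : R) : Prop :=
  forall e : R, 0 < e -> exists2 gam, gauge1 gam &
    forall n (I : 'I_n -> \bar R * \bar R) t, fine1 gam I t ->
      `|\sum_(i < n) F (t i) * incr1 g (I i) - A| < e.

Definition is_hs2 (F g : \bar R * \bar R -> R) (A : R) : Prop :=
  forall e : R, 0 < e -> exists2 gam, gauge2 gam &
    forall n (I : 'I_n -> rect) t, fine2 gam I t ->
      `|\sum_(i < n) F (t i) * incr2 g (I i) - A| < e.

Definition hs1 (F g : \bar R -> R) : R := xget 0 [set A | is_hs1 F g A].
Definition hs2 (F g : \bar R * \bar R -> R) : R := xget 0 [set A | is_hs2 F g A].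

(** Existence of the three Stieltjes integrals defining [int_prod f g]; the
    total functions [hs1] and [hs2] take a junk value otherwise. *)
Definition prod_integrable (f : testfun R -> R) (g : \bar R * \bar R -> R) :
    Prop :=
  let F := primitive f in
  [/\ exists A, is_hs1 (fun s => F (s, +oo%E)) (fun s => g (s, +oo%E)) A,
      exists A, is_hs1 (fun t => F (+oo%E, t)) (fun t => g (+oo%E, t)) A &
      exists A, is_hs2 F g A].

Definition int_prod (f : testfun R -> R) (g : \bar R * \bar R -> R) : R :=
  let F := primitive f in
  F (+oo%E, +oo%E) * g (+oo%E, +oo%E)
  - hs1 (fun s => F (s, +oo%E)) (fun s => g (s, +oo%E))
  - hs1 (fun t => F (+oo%E, t)) (fun t => g (+oo%E, t))
  + hs2 F g.

End Divisions.

Arguments Bc R : clear implicits.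
Arguments Ac R : clear implicits.
Arguments HKBV R : clear implicits.

(* Main.v *)
Require Import Defs.
From HB Require Import structures.
From mathcomp Require Import all_boot all_order all_algebra.
From mathcomp Require Import all_classical all_reals all_analysis.
From mathcomp Require Import measurable_realfun ring lra.

Set Implicit Arguments.
Unset Strict Implicit.
Unset Printing Implicit Defensive.

Import Order.TTheory GRing.Theory Num.Theory.
Import numFieldNormedType.Exports.

Local Open Scope classical_set_scope.
Local Open Scope ring_scope.

(** Everything rests on the map [d12], which sends a function of B_c to its
    mixed distributional derivative.  Once [d12] is known to be a linear
    bijection of B_c onto A_c, the order and the norm of A_c are, by
    definition, those of B_c carried over by [d12], so that A_c is a Banach
    lattice and [d12] commutes with joins, meets, absolute values and positive
    and negative parts ([iso_banach_lattice], [iso_join], [iso_meet]).  Parts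
    (b), (d), (e), (g), (h) and the lattice half of (f) then are statements on
    continuous functions, where joins and meets are pointwise maxima and
    minima ([Bc_joinE], [Bc_meetE]).  The extended plane is compact, so the sup
    norm is finite on B_c, and B_c is complete because uniform limits of
    continuous functions are continuous ([Bc_banach_lattice]).  There is no
    order unit e: with q the maximum of e and a function of B_c that is
    positive off the two lower edges, the square root of q is not dominated by
    a multiple of q, as q tends to 0 at these edges ([Bc_no_order_unit]).

    Injectivity of [d12] is the uniqueness of primitives ([d12_kernel]).  Take
    a smooth function of x that climbs from 0 to a fixed height near
    -oo and descends back to 0 near a, and a similar function of y with b in
    place of a.  The mixed derivative of their product is a sum of four products
    of bumps, concentrated near the four points (-oo, -oo), (a, -oo), (-oo, b)
    and (a, b).  Testing [d12 F] on it and letting the bumps shrink gives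
    F(-oo, -oo) + F(a, b) - F(-oo, b) - F(a, -oo), which is F(a, b) for F in
    B_c.  Conversely, functions of a single variable have zero mixed derivative
    ([d12_x], [d12_y]), by Fubini and the symmetry of second derivatives.
    Hence any continuous F has the same mixed derivative as the four point
    expression above, an element of B_c ([d12_edge_normal]); this is (i).

    What remains of (f) is that the Stieltjes integrals of a continuous F with
    respect to a function g of bounded Hardy-Krause variation exist and are
    additive in F.  Existence is a Cauchy argument.  Cut two divisions by a
    common grid: each cell of the grid lies in exactly one interval of each
    division, the increments of g add up over cells ([telescope2]), and if the
    gauge is chosen by the continuity of F then the two sums differ by at most
    the oscillation of F times the variation of g ([division2_sum_close],
    [hs2_exists]).  The value is unique because every gauge has a fine division
    ([cousin1], [cousin2]), which makes the integrals additive ([is_hs2B],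
    [int_prodB]). *)

(** * Banach lattices transported along an order isomorphism *)

Section JoinTransport.
Variables (R : realType) (V W : lmodType R) (L : onspace V) (M : onspace W).
Variable T : V -> W.
Hypothesis T_bij : set_bij (elt L) (elt M) T.
Hypothesis T_le : forall x y, elt L x -> elt L y ->
  ole L x y <-> ole M (T x) (T y).

Let T_elt x : elt L x -> elt M (T x).
Proof. by case: T_bij => h _ _; exact: h. Qed.

Let T_surj y : elt M y -> exists2 x, elt L x & T x = y.
Proof. by case: T_bij => _ _ h /h. Qed.

Lemma iso_partial_order : is_partial_order L -> is_partial_order M.
Proof.
move=> [rL aL tL]; split.
- by move=> _ /T_surj[x Lx <-]; apply/T_le => //; exact: rL.
- move=> _ _ /T_surj[x Lx <-] /T_surj[y Ly <-] /T_le xy /T_le yx.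
  by congr T; apply: aL; [| |exact: xy|exact: yx].
- move=> _ _ _ /T_surj[x Lx <-] /T_surj[y Ly <-] /T_surj[z Lz <-].
  move=> /T_le xy /T_le yz; apply/T_le => //.
  by apply: (tL _ y) => //; [exact: xy|exact: yz].
Qed.

(** Upper bounds of [T x] and [T y] are images of upper bounds of [x] and [y]. *)
Lemma iso_is_join x y z : elt L x -> elt L y ->
  is_join L x y z -> is_join M (T x) (T y) (T z).
Proof.
move=> Lx Ly [Lz xz yz zmin]; split; first exact: T_elt.
- exact/T_le.
- exact/T_le.
- move=> _ /T_surj[w Lw <-] /T_le xw /T_le yw; apply/T_le => //.
  by apply: zmin; [|exact: xw|exact: yw].
Qed.

Lemma join_eq x y z : is_partial_order L -> is_join L x y z -> join L x y = z.
Proof.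
move=> [_ aL _] jz; apply: xget_unique => // w jw.
case: jz => Lz xz yz zmin; case: jw => Lw xw yw wmin.
by apply: aL => //; [exact: wmin|exact: zmin].
Qed.

End JoinTransport.

Section Transport.
Variables (R : realType) (V W : lmodType R) (L : onspace V) (M : onspace W).
Variable T : V -> W.
Hypothesis T_bij : set_bij (elt L) (elt M) T.
Hypothesis T_le : forall x y, elt L x -> elt L y ->
  ole L x y <-> ole M (T x) (T y).

(** Meets are joins for the reversed order, so that every fact on joins holds for
    meets as well. *)
Definition dual_onspace (X : lmodType R) (K : onspace X) : onspace X :=
  ONSpace (elt K) (fun x y => ole K y x) (onorm K).

Lemma meet_dual (X : lmodType R) (K : onspace X) : meet K = join (dual_onspace K).
Proof. by []. Qed.

Lemma dual_partial_order (X : lmodType R) (K : onspace X) :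
  is_partial_order K -> is_partial_order (dual_onspace K).
Proof.
move=> [rK aK tK]; split=> //= [x y Kx Ky xy yx|x y z Kx Ky Kz xy yz].
  exact: aK.
exact: (tK _ y).
Qed.

Hypothesis T_lin : forall (a : R) x y, elt L x -> elt L y ->
  T (a *: x + y) = a *: T x + T y.
Hypothesis T_norm : forall x, elt L x -> onorm M (T x) = onorm L x.
Hypothesis L_lattice : is_banach_lattice L.

Let T_elt x : elt L x -> elt M (T x).
Proof. by case: T_bij => h _ _; exact: h. Qed.

Let T_surj y : elt M y -> exists2 x, elt L x & T x = y.
Proof. by case: T_bij => _ _ h /h. Qed.

Let L0 : elt L 0. Proof. by case: L_lattice => [[[]]]. Qed.

Let L_lin (a : R) x y : elt L x -> elt L y -> elt L (a *: x + y).
Proof. by case: L_lattice => [[[_ h] _ _] _]; exact: h. Qed.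

Let L_po : is_partial_order L. Proof. by case: L_lattice => _ []. Qed.

Let L_ex x y : elt L x -> elt L y ->
  (exists z, is_join L x y z) /\ (exists z, is_meet L x y z).
Proof. by case: L_lattice => _ [_ [h _ _ _]]; exact: h. Qed.

Lemma elt_scale (a : R) x : elt L x -> elt L (a *: x).
Proof. by move=> Lx; rewrite -[_ *: _]addr0; exact: L_lin. Qed.

Lemma elt_opp x : elt L x -> elt L (- x).
Proof. by move=> Lx; rewrite -scaleN1r; exact: elt_scale. Qed.

Lemma elt_add x y : elt L x -> elt L y -> elt L (x + y).
Proof. by move=> Lx Ly; rewrite -[x]scale1r; exact: L_lin. Qed.

Lemma elt_join x y : elt L x -> elt L y -> elt L (join L x y).
Proof.
by move=> Lx Ly; have [[z jz] _] := L_ex Lx Ly; rewrite (join_eq L_po jz); case: jz.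
Qed.

Lemma iso_zero : T 0 = 0.
Proof.
have := T_lin 1 L0 L0; rewrite !scale1r addr0 => /eqP.
by rewrite -subr_eq0 opprD addrA subrr sub0r oppr_eq0 => /eqP.
Qed.

Lemma iso_scale (a : R) x : elt L x -> T (a *: x) = a *: T x.
Proof. by move=> Lx; rewrite -[_ *: x]addr0 T_lin// iso_zero addr0. Qed.

Lemma iso_opp x : elt L x -> T (- x) = - T x.
Proof. by move=> Lx; rewrite -scaleN1r iso_scale// scaleN1r. Qed.

Lemma iso_add x y : elt L x -> elt L y -> T (x + y) = T x + T y.
Proof. by move=> Lx Ly; rewrite -[x]scale1r T_lin// !scale1r. Qed.

Lemma iso_join x y : elt L x -> elt L y -> T (join L x y) = join M (T x) (T y).
Proof.
move=> Lx Ly; have [[z jz] _] := L_ex Lx Ly.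
rewrite (join_eq L_po jz); apply/esym/join_eq; first exact: (iso_partial_order T_bij T_le L_po).
exact: (iso_is_join T_bij T_le Lx Ly jz).
Qed.

Lemma iso_meet x y : elt L x -> elt L y -> T (meet L x y) = meet M (T x) (T y).
Proof.
move=> Lx Ly; have [_ [z mz]] := L_ex Lx Ly.
have dT_le u v : elt L u -> elt L v ->
    ole (dual_onspace L) u v <-> ole (dual_onspace M) (T u) (T v).
  by move=> Lu Lv; exact: (T_le Lv Lu).
have dM : is_partial_order (dual_onspace M).
  by apply: dual_partial_order; exact: (iso_partial_order T_bij T_le).
rewrite !meet_dual (join_eq (dual_partial_order L_po) mz).
apply/esym/(join_eq dM).
exact: (@iso_is_join _ _ _ (dual_onspace L) (dual_onspace M) T).
Qed.

Lemma iso_labs x : elt L x -> T (labs L x) = labs M (T x).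
Proof. by move=> Lx; rewrite /labs iso_join ?iso_opp//; exact: elt_opp. Qed.

Lemma iso_lpos x : elt L x -> T (lpos L x) = lpos M (T x).
Proof. by move=> Lx; rewrite /lpos iso_join ?iso_zero. Qed.

Lemma iso_lneg x : elt L x -> T (lneg L x) = lneg M (T x).
Proof. by move=> Lx; rewrite /lneg iso_join ?iso_zero ?iso_opp//; exact: elt_opp. Qed.

Lemma iso_banach_lattice_iso : is_banach_lattice_iso L M T.
Proof. by split=> // x y Lx Ly; rewrite iso_join// iso_meet. Qed.

Lemma iso_banach : is_banach M.
Proof.
case: L_lattice => [[_ [n0 n0_eq nZ nD] cL] _].
split.
- split; first by rewrite -iso_zero; exact: T_elt.
  move=> a _ _ /T_surj[x Lx <-] /T_surj[y Ly <-].
  by rewrite -T_lin//; apply: T_elt; exact: L_lin.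
- split.
  + by move=> _ /T_surj[x Lx <-]; rewrite T_norm//; exact: n0.
  + by move=> _ /T_surj[x Lx <-]; rewrite T_norm// => /(n0_eq _ Lx) ->; exact: iso_zero.
  + by move=> a _ /T_surj[x Lx <-]; rewrite -iso_scale// !T_norm ?nZ//; exact: elt_scale.
  + move=> _ _ /T_surj[x Lx <-] /T_surj[y Ly <-].
    by rewrite -iso_add// !T_norm ?nD//; exact: elt_add.
- move=> u Mu cu.
  have /choice[v hv] n : exists x, elt L x /\ T x = u n.
    by have [x] := T_surj (Mu n); exists x.
  have Tv m n : T (v m - v n) = u m - u n.
    rewrite iso_add ?iso_opp//; try exact: (hv _).1.
      by rewrite !(hv _).2.
    by apply: elt_opp; exact: (hv _).1.
  have [| |x Lx vx] := cL v.
  + by move=> n; exact: (hv n).1.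
  + move=> e /cu[N hN]; exists N => m n Nm Nn.
    rewrite -T_norm ?Tv; first exact: hN.
    by apply: elt_add; [|apply: elt_opp]; exact: (hv _).1.
  + exists (T x); first exact: T_elt.
    have -> : (fun n => onorm M (u n - T x)) = (fun n => onorm L (v n - x)).
      apply/funext => n; have Lv := (hv n).1.
      rewrite -(hv n).2 -iso_opp// -iso_add ?T_norm//; last exact: elt_opp.
      by apply: elt_add => //; exact: elt_opp.
    exact: vx.
Qed.

Lemma iso_banach_lattice : is_banach_lattice M.
Proof.
split; first exact: iso_banach.
split; first exact: (iso_partial_order T_bij T_le L_po).
case: L_lattice => _ [_ [_ hD hZ hN]]; split.
- move=> _ _ /T_surj[x Lx <-] /T_surj[y Ly <-].
  have [[z jz] [w mw]] := L_ex Lx Ly; split.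
    by exists (T z); exact: (iso_is_join T_bij T_le Lx Ly jz).
  exists (T w); apply: (@iso_is_join _ _ _ (dual_onspace L) (dual_onspace M) T) mw => //.
  by move=> u v Lu Lv; exact: (T_le Lv Lu).
- move=> _ _ _ /T_surj[x Lx <-] /T_surj[y Ly <-] /T_surj[z Lz <-] /T_le xy.
  rewrite -!iso_add//; apply/T_le; try exact: elt_add.
  by apply: hD => //; exact: xy.
- move=> _ _ k /T_surj[x Lx <-] /T_surj[y Ly <-] k0 /T_le xy.
  rewrite -!iso_scale//; apply/T_le; try exact: elt_scale.
  by apply: hZ => //; exact: xy.
- move=> _ _ /T_surj[x Lx <-] /T_surj[y Ly <-].
  rewrite -!iso_labs// !T_norm// => /T_le xy; apply: hN => //; apply: xy;
    by apply: elt_join => //; exact: elt_opp.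
Qed.

Lemma iso_order_unit : (exists e, is_order_unit M e) -> exists e, is_order_unit L e.
Proof.
move=> [_ [/T_surj[e Le <-] e0 he]]; exists e; split=> //.
  by apply/T_le => //; rewrite iso_zero.
move=> x Lx; have [l l0 xl] := he _ (T_elt Lx).
exists l => //; apply/T_le; last by rewrite iso_labs// iso_scale.
  by apply: elt_join => //; exact: elt_opp.
exact: elt_scale.
Qed.

End Transport.

(** * The Banach lattice of continuous functions on the extended plane *)

Lemma continuous_pairr (T U : topologicalType) (b : U) :
  continuous (fun x : T => (x, b)).
Proof. by move=> x; apply: cvg_pair => //=; exact: cvg_cst. Qed.

Lemma continuous_pairl (T U : topologicalType) (a : T) :
  continuous (fun x : U => (a, x)).
Proof. by move=> x; apply: cvg_pair => //=; exact: cvg_cst. Qed.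

Lemma continuous_map_pair (T U T' U' : topologicalType) (f : T -> T') (g : U -> U') :
  continuous f -> continuous g -> continuous (fun z : T * U => (f z.1, g z.2)).
Proof.
move=> cf cg z A [[B C] /= [nB nC] BCA].
exists (f @^-1` B, g @^-1` C); first by split; [exact: cf|exact: cg].
by move=> w [? ?]; exact: BCA.
Qed.

Section ExtendedPlane.
Variable R : realType.
Implicit Types (F G : \bar R * \bar R -> R).

(** The distance of the extended line is that of the images under [contract]. *)
Lemma continuous_contract : continuous (@contract R : \bar R -> R).
Proof.
move=> x; apply/cvgrPdist_lt => e e0; near=> y.
by near: y; exact: (nbhsx_ballx x e e0).
Unshelve. all: by end_near. Qed.

(** The extended line is the isometric image of [[-1, 1]] under [expand]. *)
Lemma compact_ereal : compact [set: \bar R].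
Proof.
have -> : [set: \bar R] = (@expand R : R -> \bar R) @` `[-1, 1]%classic.
  apply/seteqP; split=> // x _; exists (contract x); last exact: contractK.
  by rewrite /= in_itv/= -ler_norml contract_le1.
apply: continuous_compact; last exact: segment_compact.
apply/subspace_continuousP => x x1; apply/cvg_ballP => e e0.
rewrite near_withinE; near=> y => y1.
have in1 (z : R) : z \in `[-1, 1]%R -> contract (expand z) = z.
  by rewrite in_itv/= -ler_norml => z1; exact: expandK.
rewrite /ball/= /ereal_ball (in1 x x1) (in1 y y1).
by near: y; exact: (nbhsx_ballx x e e0).
Unshelve. all: by end_near. Qed.

Lemma compact_ereal2 : compact [set: \bar R * \bar R].
Proof. by rewrite -setXTT; apply: compact_setX; exact: compact_ereal. Qed.

Definition bounded_on_plane F := exists M, forall z, `|F z| <= M.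

Lemma continuous_bounded F : continuous F -> bounded_on_plane F.
Proof.
move=> cF; have := @continuous_compact _ _ F setT.
move=> /(_ (continuous_subspaceT cF) compact_ereal2)/compact_bounded.
case=> M [_ /(_ (M + 1))]; rewrite ltrDl ltr01 => /(_ isT) h.
by exists (M + 1) => z; apply: h; exists z.
Qed.

Lemma supnorm_ge F z : bounded_on_plane F -> `|F z| <= supnorm F.
Proof.
move=> [M FM]; apply: ub_le_sup; last by exists z.
by exists M => _ [y _ <-].
Qed.

Lemma supnorm_le F M : (forall z, `|F z| <= M) -> supnorm F <= M.
Proof.
move=> FM; apply: ge_sup; first by exists `|F (0%E, 0%E)|, (0%E, 0%E).
by move=> _ [y _ <-].
Qed.

Lemma Bc_bounded F : Bc_set F -> bounded_on_plane F.
Proof. by move=> [/continuous_bounded]. Qed.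

Lemma Bc_lin (a : R) F G : Bc_set F -> Bc_set G -> Bc_set (a *: F + G).
Proof.
move=> [cF F0] [cG G0]; split.
  move=> z; apply: continuousD; last exact: cG.
  by apply: cvgZl_tmp; exact: cF.
move=> s; rewrite !fctE.
by rewrite (F0 s).1 (F0 s).2 (G0 s).1 (G0 s).2 scaler0 addr0.
Qed.

Lemma Bc0 : Bc_set (0 : \bar R * \bar R -> R).
Proof. by split=> [z|s//]; exact: cst_continuous. Qed.

Lemma BcN F : Bc_set F -> Bc_set (- F).
Proof. by move=> BF; rewrite -scaleN1r -[X in Bc_set X]addr0; exact: Bc_lin BF Bc0. Qed.

Lemma BcB F G : Bc_set F -> Bc_set G -> Bc_set (F - G).
Proof. by move=> BF BG; rewrite addrC -scaleN1r; exact: Bc_lin. Qed.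

Lemma Bc_max F G : Bc_set F -> Bc_set G -> Bc_set (F \max G).
Proof.
move=> [cF F0] [cG G0]; split.
  by move=> z; apply: continuous_max; [exact: cF|exact: cG].
by move=> s; rewrite /= (F0 s).1 (F0 s).2 (G0 s).1 (G0 s).2 maxxx.
Qed.

Lemma Bc_min F G : Bc_set F -> Bc_set G -> Bc_set (F \min G).
Proof.
move=> [cF F0] [cG G0]; split.
  by move=> z; apply: continuous_min; [exact: cF|exact: cG].
by move=> s; rewrite /= (F0 s).1 (F0 s).2 (G0 s).1 (G0 s).2 minxx.
Qed.

Lemma Bc_is_joinE F G : Bc_set F -> Bc_set G ->
  [set H | is_join (Bc R) F G H] = [set F \max G].
Proof.
move=> BF BG; apply/seteqP; split=> [H [/= BH FH GH min_H]|_ ->]; last first.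
  split=> /=[|z|z|H _ FH GH z]; rewrite ?le_max ?lexx ?orbT//; first exact: Bc_max.
  by rewrite ge_max FH GH.
apply/funext => z; apply/eqP; rewrite eq_le /= ge_max (FH z) (GH z) !andbT.
by apply: (min_H _ (Bc_max BF BG) _ _ z) => y; rewrite /= le_max lexx ?orbT.
Qed.

Lemma Bc_is_meetE F G : Bc_set F -> Bc_set G ->
  [set H | is_meet (Bc R) F G H] = [set F \min G].
Proof.
move=> BF BG; apply/seteqP; split=> [H [/= BH FH GH min_H]|_ ->]; last first.
  split=> /=[|z|z|H _ FH GH z]; rewrite ?ge_min ?lexx ?orbT//; first exact: Bc_min.
  by rewrite le_min FH GH.
apply/funext => z; apply/eqP; rewrite eq_le /= le_min (FH z) (GH z) /= ?andbT.
by apply: (min_H _ (Bc_min BF BG) _ _ z) => y; rewrite /= ge_min lexx ?orbT.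
Qed.

Lemma Bc_joinE F G : Bc_set F -> Bc_set G -> join (Bc R) F G = F \max G.
Proof. by move=> BF BG; rewrite /join Bc_is_joinE//; apply: xget_unique. Qed.

Lemma Bc_meetE F G : Bc_set F -> Bc_set G -> meet (Bc R) F G = F \min G.
Proof. by move=> BF BG; rewrite /meet Bc_is_meetE//; apply: xget_unique. Qed.

Lemma Bc_labsE F : Bc_set F -> labs (Bc R) F = (fun z => `|F z|).
Proof.
by move=> BF; rewrite /labs Bc_joinE//; [apply/funext => z; rewrite /= fctE maxrN|exact: BcN].
Qed.

Lemma Bc_is_subspace : is_subspace (Bc R).
Proof. by split; [exact: Bc0|exact: Bc_lin]. Qed.

Lemma Bc_is_norm : is_norm (Bc R).
Proof.
split=> /= [F BF|F BF F0|a F BF|F G BF BG].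
- exact: le_trans (normr_ge0 (F (0%E, 0%E))) (supnorm_ge _ (Bc_bounded BF)).
- apply/funext => z; apply/eqP; rewrite -normr_le0 -F0.
  exact/supnorm_ge/Bc_bounded.
- apply/eqP; rewrite eq_le; apply/andP; split.
    apply: supnorm_le => z; rewrite fctE normrM ler_wpM2l//.
    exact/supnorm_ge/Bc_bounded.
  have [->|a0] := eqVneq a 0.
    by rewrite normr0 mul0r scale0r
      (le_trans (normr_ge0 ((0 : \bar R * \bar R -> R) (0%E, 0%E))))
      ?(supnorm_ge _ (Bc_bounded Bc0)).
  rewrite mulrC -ler_pdivlMr ?normr_gt0//; apply: supnorm_le => z.
  rewrite ler_pdivlMr ?normr_gt0// mulrC -normrM.
  apply: (@supnorm_ge (a *: F)); apply: Bc_bounded.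
  by rewrite -[a *: F]addr0; exact: Bc_lin BF Bc0.
- apply: supnorm_le => z; rewrite (le_trans (ler_normD _ _))// lerD//.
    exact/supnorm_ge/Bc_bounded.
  exact/supnorm_ge/Bc_bounded.
Qed.

(** The limit is taken pointwise; the Cauchy condition is uniform in the point, so
    the convergence is uniform and continuity passes to the limit. *)
Lemma Bc_is_complete : is_complete (Bc R).
Proof.
move=> u Bu /= cu.
have uB m n : bounded_on_plane (u m - u n) by apply: Bc_bounded; exact: BcB (Bu m) (Bu n).
have cuz z : cvgn (fun n => u n z).
  apply: cauchy_cvg; apply/cauchy_exP => e e0.
  have [N hN] := cu _ e0; exists (u N z); exists N => // n /= Nn.
  exact: le_lt_trans (supnorm_ge z (uB N n)) (hN N n (leqnn N) Nn).
pose G z : R := limn (fun n => u n z).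
have uG (e : R) : 0 < e -> exists N, forall n z, (N <= n)%N -> `|u n z - G z| <= e.
  move=> e0; have [N hN] := cu _ e0; exists N => n z Nn.
  have cn : `|u n z - u m z| @[m --> \oo] --> `|u n z - G z|.
    by apply: cvg_norm; apply: cvgB; [exact: cvg_cst|exact: cuz].
  rewrite -(cvg_lim _ cn)//; apply: limr_le; first by apply/cvg_ex; exists `|u n z - G z|.
  near=> m.
  apply/ltW/(le_lt_trans (supnorm_ge z (uB n m)))/hN => //.
  by near: m; exact: nbhs_infty_ge.
have BG : Bc_set G.
  split=> [x|s].
    apply/cvgrPdist_le => e e0.
    have [N hN] := uG (e / 3) (divr_gt0 e0 (ltr0n _ 3)).
    have cN : \forall y \near x, `|u N x - u N y| <= e / 3.
      by have /cvgrPdist_le/(_ _ (divr_gt0 e0 (ltr0n _ 3))) := (Bu N).1 x.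
    near=> y.
    have h1 := hN N x (leqnn N); have h2 := hN N y (leqnn N).
    have h3 : `|u N x - u N y| <= e / 3 by near: y.
    move: h1 h2 h3; rewrite !ler_norml => /andP[? ?] /andP[? ?] /andP[? ?].
    by apply/andP; split; lra.
  rewrite /G; split.
    by under eq_fun do rewrite ((Bu _).2 s).1; exact: lim_cst.
  by under eq_fun do rewrite ((Bu _).2 s).2; exact: lim_cst.
exists G => //; apply/cvgr0Pnorm_le => e e0.
have [N hN] := uG e e0; exists N => // n /= Nn.
rewrite ger0_norm; first by apply: supnorm_le => z; exact: hN.
exact: le_trans (normr_ge0 ((u n - G) (0%E, 0%E))) (supnorm_ge _ (Bc_bounded (BcB (Bu n) BG))).
Unshelve. all: by end_near. Qed.

Lemma Bc_banach_lattice : is_banach_lattice (Bc R).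
Proof.
split; first by split; [exact: Bc_is_subspace|exact: Bc_is_norm|exact: Bc_is_complete].
split.
  split=> /= [F _ z//|F G _ _ FG GF|F G H _ _ _ FG GH z].
    by apply/funext => z; apply/eqP; rewrite eq_le FG GF.
  exact: le_trans (FG z) (GH z).
split=> /= [F G BF BG|F G H _ _ _ FG z|F G k _ _ k0 FG z|F G BF BG].
- split; [exists (F \max G)|exists (F \min G)].
    by have /seteqP[_] := Bc_is_joinE BF BG; exact.
  by have /seteqP[_] := Bc_is_meetE BF BG; exact.
- by rewrite !fctE lerD2r.
- exact: ler_wpM2l.
- rewrite !Bc_labsE// => FG; apply: supnorm_le => z.
  exact: le_trans (FG z) (supnorm_ge z (Bc_bounded BG)).
Qed.

(** The square root grows faster than linearly at 0: if [e] were an order unit,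
    the square root of a function [q >= e] that is positive off the lower edges
    would be at most [l * q], hence at least [1 / l] off these edges, whereas it
    tends to 0 there. *)
Lemma Bc_no_order_unit : ~ exists e, is_order_unit (Bc R) e.
Proof.
move=> [e [/= Be e0 he]].
(* p is positive exactly off the two lower edges *)
pose p (z : \bar R * \bar R) : R := (1 + contract z.1) * (1 + contract z.2).
have cp : continuous p.
  move=> z; apply: cvgM; (apply: cvgD; first exact: cvg_cst).
    by apply: continuous_comp; [exact: cvg_fst|exact: continuous_contract].
  by apply: continuous_comp; [exact: cvg_snd|exact: continuous_contract].
have Bp : Bc_set p.
  split=> // s; rewrite /p /=.
  by split; [rewrite addrN mul0r|rewrite addrN mulr0].
have Bq := Bc_max Be Bp.
pose q := e \max p; pose r z := Num.sqrt (q z).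
have Br : Bc_set r.
  split.
    by move=> z; apply: continuous_comp; [exact: Bq.1|exact: sqrt_continuous].
  move=> s; have [q1 q2] : q (-oo%E, s) = 0 /\ q (s, -oo%E) = 0 := Bq.2 s.
  by rewrite /r q1 q2 sqrtr0.
have [l l0] := he r Br; rewrite Bc_labsE// => hl.
have p0 (x : R) : 0 < p (x%:E, +oo%E).
  have h : contract x%:E != -1 :> R by rewrite contract_eqN1.
  have := contract_le1 x%:E; rewrite ler_norml => /andP[]; rewrite /p /=.
  rewrite le_eqVlt eq_sym (negbTE h) /= => h1 _.
  by apply: mulr_gt0; [rewrite -ltrBlDl sub0r|rewrite addr_gt0].
have q0 (x : R) : 0 < q (x%:E, +oo%E) by rewrite /q/= lt_max p0 orbT.
have big (x : R) : l^-1 <= r (x%:E, +oo%E).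
  have r0 : 0 < r (x%:E, +oo%E) by rewrite /r sqrtr_gt0.
  have h : r (x%:E, +oo%E) <= l * e (x%:E, +oo%E).
    exact: le_trans (ler_norm _) (hl (x%:E, +oo%E)).
  have eq : e (x%:E, +oo%E) <= r (x%:E, +oo%E) * r (x%:E, +oo%E).
    rewrite -expr2 sqr_sqrtr; last exact/ltW/q0.
    by rewrite /q/= le_max lexx.
  have := le_trans h (ler_wpM2l (ltW l0) eq).
  by rewrite mulrA -{1}[r _]mul1r ler_pM2r// mulrC -ler_pdivrMr// mul1r.
pose h (x : \bar R) : \bar R * \bar R := (x, +oo%E).
have /cvgrPdist_lt/(_ l^-1) : {for -oo%E, continuous (r \o h)}.
  by apply: continuous_comp; [exact: continuous_pairr|exact: Br.1].
rewrite invr_gt0 l0 => /(_ isT)[M [_ /(_ (M - 1)%:E)]]; rewrite lte_fin gtrDl ltrN10 => /(_ isT).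
by rewrite /= /h (Br.2 _).1 sub0r normrN ger0_norm ?sqrtr_ge0// ltNge big.
Qed.

End ExtendedPlane.

(** * Lattice identities for continuous functions *)

Section LatticeFacts.
Variable R : realType.
Implicit Types (F G H : \bar R * \bar R -> R).

Lemma Bc_lposE F : Bc_set F -> lpos (Bc R) F = F \max 0.
Proof. by move=> BF; rewrite /lpos Bc_joinE//; exact: Bc0. Qed.

Lemma Bc_lnegE F : Bc_set F -> lneg (Bc R) F = (- F) \max 0.
Proof. by move=> BF; rewrite /lneg Bc_joinE//; [exact: BcN|exact: Bc0]. Qed.

Lemma Bc_jordan F : Bc_set F -> F = lpos (Bc R) F - lneg (Bc R) F.
Proof.
move=> BF; rewrite Bc_lposE// Bc_lnegE//; apply/funext => z; rewrite !fctE /=.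
by case: (leP (F z) 0) => h; case: (leP (- F z) 0) => h'; lra.
Qed.

Lemma Bc_labs F : Bc_set F -> Bc_set (labs (Bc R) F).
Proof. by move=> BF; rewrite /labs Bc_joinE//; [apply: Bc_max => //|]; exact: BcN. Qed.

Lemma Bc_lpos F : Bc_set F -> Bc_set (lpos (Bc R) F).
Proof. by move=> BF; rewrite Bc_lposE//; apply: Bc_max => //; exact: Bc0. Qed.

Lemma Bc_lneg F : Bc_set F -> Bc_set (lneg (Bc R) F).
Proof. by move=> BF; rewrite Bc_lnegE//; apply: Bc_max; [exact: BcN|exact: Bc0]. Qed.

Lemma supnorm_labs F : Bc_set F -> supnorm (labs (Bc R) F) = supnorm F.
Proof.
by move=> BF; rewrite /supnorm Bc_labsE//; under eq_fun do rewrite normr_id.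
Qed.

Lemma supnorm_lpos F : Bc_set F -> supnorm (lpos (Bc R) F) <= supnorm F.
Proof.
move=> BF; apply: supnorm_le => z; apply: le_trans (supnorm_ge z (Bc_bounded BF)).
rewrite Bc_lposE//= ger0_norm ?le_max ?lexx ?orbT//.
by rewrite ge_max ler_norm normr_ge0.
Qed.

Lemma supnorm_lneg F : Bc_set F -> supnorm (lneg (Bc R) F) <= supnorm F.
Proof.
move=> BF; apply: supnorm_le => z; apply: le_trans (supnorm_ge z (Bc_bounded BF)).
rewrite Bc_lnegE//= ger0_norm ?le_max ?lexx ?orbT//.
by rewrite ge_max normr_ge0 andbT fctE -normrN ler_norm.
Qed.

Lemma Bc_meet_join F G H : Bc_set F -> Bc_set G -> Bc_set H ->
  meet (Bc R) F (join (Bc R) G H) = join (Bc R) (meet (Bc R) F G) (meet (Bc R) F H).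
Proof.
move=> BF BG BH; rewrite !Bc_joinE ?Bc_meetE//; try exact: Bc_min; try exact: Bc_max.
by apply/funext => z; exact: min_maxr.
Qed.

Lemma Bc_join_meet F G H : Bc_set F -> Bc_set G -> Bc_set H ->
  join (Bc R) F (meet (Bc R) G H) = meet (Bc R) (join (Bc R) F G) (join (Bc R) F H).
Proof.
move=> BF BG BH; rewrite !Bc_meetE ?Bc_joinE//; try exact: Bc_min; try exact: Bc_max.
by apply/funext => z; exact: max_minr.
Qed.

Lemma Bc_modular F G H : Bc_set F -> Bc_set G -> Bc_set H -> Bc_le F G ->
  join (Bc R) F (meet (Bc R) G H) = meet (Bc R) G (join (Bc R) F H).
Proof.
move=> BF BG BH FG; rewrite Bc_join_meet// [join _ F G](_ : _ = G)//.
by rewrite Bc_joinE//; apply/funext => z; exact/max_idPr.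
Qed.

End LatticeFacts.

(** * Divisions, grids and half-open cells *)

Section Order.
Variable R : realType.
Implicit Types (a b x u : \bar R) (I J c : \bar R * \bar R) (r : rect R).

Lemma ereal_between a b : (a < b)%E -> exists x : R, (a < x%:E < b)%E.
Proof.
case: a b => [a| |] [b| |] // ab.
- exists ((a + b) / 2); move: ab; rewrite !lte_fin => ab.
  by apply/andP; split; lra.
- by exists (a + 1); rewrite lte_fin ltrDl ltr01 ltry.
- by exists (b - 1); rewrite lte_fin gtrDl ltrN10 ltNyr.
- by exists 0; rewrite ltNyr ltry.
Qed.

(** Finitely many points leave a gap just below [u]; a point of that gap lies on
    the same side as [u] of each of them that is smaller than [u]. *)
Lemma ereal_below_gap (s : seq (\bar R)) u : (-oo < u)%E ->
  exists2 v, (v < u)%E & forall e, e \in s -> (e < u)%E -> (e < v)%E.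
Proof.
move=> u0; elim: s => [|e s [v vu hv]].
  by have [x /andP[_ xu]] := ereal_between u0; exists x%:E.
have [eu|ue] := ltP e u; last first.
  exists v => // e'; rewrite inE => /predU1P[->|/hv//].
  by rewrite ltNge ue.
have mu : (Order.max e v < u)%E by rewrite gt_max eu vu.
have [x /andP[]] := ereal_between mu; rewrite gt_max => /andP[ex vx] xu.
exists x%:E => // e'; rewrite inE => /predU1P[->//|/hv h /h e'v].
exact: lt_trans e'v vx.
Qed.

(** Two nondegenerate intervals overlap in a null set exactly when one of them
    ends no later than the other begins ([overlap_sep], [overlap_pos]); this turns the
    measure condition on divisions into a condition on endpoints. *)
Definition sep I J : bool := (I.2 <= J.1)%E || (J.2 <= I.1)%E.
Definition sep2 r r' : bool := sep r.1 r'.1 || sep r.2 r'.2.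

Lemma sepC I J : sep I J = sep J I.
Proof. by rewrite /sep orbC. Qed.

Lemma sep2C r r' : sep2 r r' = sep2 r' r.
Proof. by rewrite /sep2 !(sepC r.1) !(sepC r.2). Qed.

Definition overlap I J : set R := [set x : R | itv1 I x%:E /\ itv1 J x%:E].

Lemma overlapE I J : overlap I J =
  [set x : R | (Order.max I.1 J.1 <= x%:E <= Order.min I.2 J.2)%E].
Proof.
apply/seteqP; split=> x; rewrite /overlap /itv1 /= !in_itv/=.
  by rewrite ge_max le_min => -[/andP[-> ->] /andP[-> ->]].
by rewrite ge_max le_min => /andP[/andP[-> ->] /andP[-> ->]].
Qed.

Lemma overlap_sep I J : sep I J -> lebesgue_measure (overlap I J) = 0%E.
Proof.
move=> IJ; apply: countable_lebesgue_measure0.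
apply: (@sub_countable _ _ _ [set fine (Order.max I.1 J.1)]); last exact: countable1.
apply: subset_card_le => x; rewrite overlapE/= => /andP[mx xm].
suff -> : Order.max I.1 J.1 = x%:E by [].
apply/le_anti/andP; split=> //.
apply: le_trans xm _; rewrite ge_min !le_max.
by case/orP : IJ => ->; rewrite ?orbT.
Qed.

Lemma nonsep_open I J : (I.1 < I.2)%E -> (J.1 < J.2)%E -> ~~ sep I J ->
  exists u v : R, u < v /\ `]u, v[%classic `<=` overlap I J.
Proof.
move=> I12 J12; rewrite /sep negb_or -!ltNge => /andP[IJ JI].
have : (Order.max I.1 J.1 < Order.min I.2 J.2)%E.
  by rewrite gt_max !lt_min I12 J12 IJ JI.
move=> /ereal_between[u /andP[mu]] /ereal_between[v /andP[uv vm]].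
exists u, v; split; first by rewrite -lte_fin.
move=> x; rewrite overlapE/= in_itv/= => /andP[ux xv].
apply/andP; split.
  by rewrite (le_trans (ltW mu))// lee_fin ltW.
by rewrite (le_trans _ (ltW vm))// lee_fin ltW.
Qed.

Lemma measurable_overlap I J : measurable (overlap I J).
Proof.
have -> : overlap I J = (@EFin R) @^-1` `[Order.max I.1 J.1, Order.min I.2 J.2]%classic.
  by rewrite overlapE; apply/seteqP; split=> x /=; rewrite in_itv.
by rewrite -[X in measurable X]setTI; apply: EFin_measurable => //; exact: emeasurable_itv.
Qed.

Lemma overlap_pos I J : (I.1 < I.2)%E -> (J.1 < J.2)%E -> ~~ sep I J ->
  lebesgue_measure (overlap I J) != 0%E.
Proof.
move=> I12 J12 /(nonsep_open I12 J12)[u [v [uv uvo]]].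
have : (lebesgue_measure (`]u, v[%classic : set R) <= lebesgue_measure (overlap I J))%E.
  by apply: le_measure => //; rewrite inE; [exact: measurable_itv|exact: measurable_overlap].
rewrite lebesgue_measure_itv/= lte_fin uv -EFinB => h.
apply: contraTneq h => ->; rewrite -ltNge lte_fin.
by rewrite subr_gt0.
Qed.

Definition overlap2 r r' : set (R * R) :=
  [set z : R * R | itv2 r (z.1%:E, z.2%:E) /\ itv2 r' (z.1%:E, z.2%:E)].

Lemma overlap2E r r' : overlap2 r r' = overlap r.1 r'.1 `*` overlap r.2 r'.2.
Proof.
apply/seteqP; split=> z; rewrite /overlap2 /overlap /itv2 /=.
  by case=> -[? ?] [? ?].
by case=> -[? ?] [? ?].
Qed.

Lemma overlap2_measure r r' :
  (lebesgue_measure \x lebesgue_measure)%E (overlap2 r r') =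
  (lebesgue_measure (overlap r.1 r'.1) * lebesgue_measure (overlap r.2 r'.2))%E.
Proof. by rewrite overlap2E product_measure1E//; exact: measurable_overlap. Qed.

Lemma overlap2_sep r r' : sep2 r r' ->
  (lebesgue_measure \x lebesgue_measure)%E (overlap2 r r') = 0%E.
Proof.
by rewrite overlap2_measure => /orP[] /overlap_sep ->; rewrite ?mul0e ?mule0.
Qed.

Lemma division1_sep n (I : 'I_n -> \bar R * \bar R) i j :
  division1 I -> i != j -> sep (I i) (I j).
Proof.
move=> [lI _ hI] /hI h; apply: contrapT => /negP/(overlap_pos (lI i) (lI j)).
by move/eqP; apply.
Qed.

Lemma division2_sep n (I : 'I_n -> rect R) i j :
  division2 I -> i != j -> sep2 (I i) (I j).
Proof.
move=> [lI _ hI] /hI h; apply: contrapT => /negP; rewrite negb_or => /andP[].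
move=> /(overlap_pos (lI i).1 (lI j).1) h1 /(overlap_pos (lI i).2 (lI j).2) h2.
move: h => /eqP; rewrite -[X in (_ \x _)%E X]/(overlap2 (I i) (I j)).
by rewrite overlap2_measure mule_eq0 (negbTE h1) (negbTE h2).
Qed.

(** Half-open membership: an endpoint shared by two neighbours belongs only to the
    left one, so a division splits the points above -oo into disjoint classes. *)
Definition hmem u I : bool := (I.1 < u)%E && (u <= I.2)%E.
Definition hmem2 (z : \bar R * \bar R) r : bool := hmem z.1 r.1 && hmem z.2 r.2.

Lemma hmem_sep u I J : sep I J -> hmem u I -> hmem u J -> False.
Proof.
move=> /orP[] h /andP[u1 u2] /andP[v1 v2].
  by have := lt_le_trans v1 (le_trans u2 h); rewrite ltxx.
by have := lt_le_trans u1 (le_trans v2 h); rewrite ltxx.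
Qed.

Lemma hmem_closed u v I : (v < u)%E -> ((I.2 < u)%E -> (I.2 < v)%E) ->
  itv1 I v -> hmem u I.
Proof.
rewrite /itv1 /= in_itv /= /hmem => vu h /andP[Iv vI].
rewrite (le_lt_trans Iv vu) /= leNgt; apply/negP => /h.
by rewrite ltNge vI.
Qed.

Lemma hmem_itv u I : hmem u I -> itv1 I u.
Proof. by move=> /andP[h1 h2]; rewrite /itv1 /= in_itv/= (ltW h1). Qed.

Lemma hmem2_itv z r : hmem2 z r -> itv2 r z.
Proof. by move=> /andP[/hmem_itv h1 /hmem_itv h2]. Qed.

(** Existence: a point slightly below [u], in the gap left by the right endpoints,
    lies in a closed interval of the division, and that interval reaches [u].
    Uniqueness: separated intervals have no common half-open point. *)
Lemma division1_hmem n (I : 'I_n -> \bar R * \bar R) u :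
  division1 I -> (-oo < u)%E ->
  exists2 i, hmem u (I i) & forall j, hmem u (I j) -> j = i.
Proof.
move=> dI u0; have [_ cI _] := dI.
have [v vu hv] := ereal_below_gap [seq (I i).2 | i <- enum 'I_n] u0.
have [i _ vi] : (\bigcup_i itv1 (I i)) v by rewrite cI.
have ui : hmem u (I i).
  by apply: hmem_closed vi => //; apply: hv; apply: map_f; rewrite mem_enum.
exists i => // j uj; apply: contrapT => /eqP ji.
exact: hmem_sep (division1_sep dI ji) uj ui.
Qed.

Lemma division2_hmem n (I : 'I_n -> rect R) (z : \bar R * \bar R) :
  division2 I -> (-oo < z.1)%E -> (-oo < z.2)%E ->
  exists2 i, hmem2 z (I i) & forall j, hmem2 z (I j) -> j = i.
Proof.
move=> dI z1 z2; have [_ cI _] := dI.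
have [v1 vz1 hv1] := ereal_below_gap [seq (I i).1.2 | i <- enum 'I_n] z1.
have [v2 vz2 hv2] := ereal_below_gap [seq (I i).2.2 | i <- enum 'I_n] z2.
have [i _ [/= vi1 vi2]] : (\bigcup_i itv2 (I i)) (v1, v2) by rewrite cI.
have zi : hmem2 z (I i).
  apply/andP; split.
    apply: hmem_closed vi1 => //; apply: hv1.
    by apply/mapP; exists i; rewrite ?mem_enum.
  apply: hmem_closed vi2 => //; apply: hv2.
  by apply/mapP; exists i; rewrite ?mem_enum.
exists i => // j zj; apply: contrapT => /eqP ji.
move: zj zi => /andP[zj1 zj2] /andP[zi1 zi2].
by have /orP[h|h] := division2_sep dI ji; [exact: hmem_sep h zj1 zi1|exact: hmem_sep h zj2 zi2].
Qed.

Lemma seq_division1 (s : seq (\bar R * \bar R)) :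
  (forall c, c \in s -> (c.1 < c.2)%E) ->
  (forall x, exists2 c, c \in s & itv1 c x) ->
  pairwise sep s -> division1 (tnth (in_tuple s)).
Proof.
move=> ls cs ps; split=> [i||i j ij].
- exact/ls/mem_tnth.
- apply/seteqP; split=> // x _; have [c /(tnthP (in_tuple s))[i ->] cx] := cs x.
  by exists i.
- apply: overlap_sep.
  have d : \bar R * \bar R by exact: (0%E, 0%E).
  rewrite !(tnth_nth d) /=.
  have hp := pairwiseP d ps.
  by have [ij'|ji'|/val_inj h] := ltngtP (val i) (val j);
    [| |by rewrite h eqxx in ij]; [|rewrite sepC]; apply: hp; rewrite ?inE//; exact: ltn_ord.
Qed.

Lemma seq_division2 (s : seq (rect R)) :
  (forall r, r \in s -> (r.1.1 < r.1.2)%E /\ (r.2.1 < r.2.2)%E) ->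
  (forall z, exists2 r, r \in s & itv2 r z) ->
  pairwise sep2 s -> division2 (tnth (in_tuple s)).
Proof.
move=> ls cs ps; split=> [i||i j ij].
- exact/ls/mem_tnth.
- apply/seteqP; split=> // x _; have [c /(tnthP (in_tuple s))[i ->] cx] := cs x.
  by exists i.
- apply: overlap2_sep.
  have d : rect R by exact: ((0%E, 0%E), (0%E, 0%E)).
  rewrite !(tnth_nth d) /=.
  have hp := pairwiseP d ps.
  by have [ij'|ji'|/val_inj h] := ltngtP (val i) (val j);
    [| |by rewrite h eqxx in ij]; [|rewrite sep2C]; apply: hp; rewrite ?inE//; exact: ltn_ord.
Qed.

Definition cells (x0 : \bar R) (s : seq (\bar R)) := zip (x0 :: s) s.

Lemma cells_cons x0 u s : cells x0 (u :: s) = (x0, u) :: cells u s.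
Proof. by []. Qed.

Lemma cells_cat x0 s t : cells x0 (s ++ t) = cells x0 s ++ cells (last x0 s) t.
Proof. by elim: s x0 => //= u s IH x0; rewrite !cells_cons IH. Qed.

Lemma cells_lt x0 s c : path <%O x0 s -> c \in cells x0 s ->
  (x0 <= c.1)%E /\ (c.1 < c.2)%E.
Proof.
elim: s x0 => //= u s IH x0 /andP[x0u us]; rewrite inE => /predU1P[->//|cs].
by have [h1 h2] := IH _ us cs; split=> //; exact: le_trans (ltW x0u) h1.
Qed.

Lemma cells_sep x0 s : path <%O x0 s -> pairwise sep (cells x0 s).
Proof.
elim: s x0 => //= u s IH x0 /andP[x0u us]; rewrite IH// andbT.
by apply/allP => c /(cells_lt us)[h _]; rewrite /sep /= h.
Qed.

Lemma cells_cover x0 s x : path <%O x0 s -> s != [::] ->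
  (x0 <= x)%E -> (x <= last x0 s)%E -> exists2 c, c \in cells x0 s & itv1 c x.
Proof.
elim: s x0 => //= u s IH x0 /andP[x0u us] _ x0x xl.
have [xu|ux] := leP x u.
  by exists (x0, u); rewrite ?mem_head// /itv1/= in_itv/= x0x.
case: s => [|v s] in IH us xl *; first by move: xl; rewrite /= leNgt ux.
by have [c cs cx] := IH u us isT (ltW ux) xl; exists c; rewrite // inE cs orbT.
Qed.

Definition grid (s : seq (\bar R)) : Prop :=
  path <%O (-oo)%E s /\ last (-oo)%E s = +oo%E.

Lemma grid_cover s x : grid s -> exists2 c, c \in cells -oo s & itv1 c x.
Proof.
move=> [ps ls]; apply: cells_cover => //; rewrite ?leNye ?ls ?leey//.
by apply: contra_eq_neq ls => ->.
Qed.

Lemma grid_division1 s : grid s -> division1 (tnth (in_tuple (cells -oo s))).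
Proof.
move=> gs; apply: seq_division1.
- by move=> c /(cells_lt gs.1)[].
- by move=> x; exact: grid_cover.
- exact: cells_sep gs.1.
Qed.

Lemma pairwise_sep2_allpairs (ds : seq (\bar R * \bar R))
    (cs : \bar R * \bar R -> seq (\bar R * \bar R)) :
  pairwise sep ds -> (forall d, pairwise sep (cs d)) ->
  pairwise sep2 [seq (c, d) | d <- ds, c <- cs d].
Proof.
move=> pd pc; elim: ds pd => //= d ds IH /andP[/allP ad pd].
rewrite pairwise_cat IH// andbT; apply/andP; split.
  apply/allrelP => _ _ /mapP[c _ ->] /allpairsPdep[d' [c' [dd' _ ->]]].
  by rewrite /sep2 /= (ad _ dd') orbT.
by rewrite pairwise_map; apply: sub_pairwise (pc d) => c c'; rewrite /sep2 /= => ->.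
Qed.

(** The columns over the rows of [t] may be cut differently: this generality is used
    for fine divisions of the plane, which are built one row at a time. *)
Lemma grid_division2 (t : seq (\bar R)) (s : \bar R * \bar R -> seq (\bar R)) :
  grid t -> (forall d, grid (s d)) ->
  division2 (tnth (in_tuple [seq (c, d) | d <- cells -oo t, c <- cells -oo (s d)])).
Proof.
move=> gt gs; apply: seq_division2.
- move=> _ /allpairsPdep[d [c [dt cs ->]]] /=.
  by split; [have [] := cells_lt (gs d).1 cs|have [] := cells_lt gt.1 dt].
- move=> [x y]; have [d dt dy] := grid_cover y gt.
  have [c cs cx] := grid_cover x (gs d).
  by exists (c, d) => //; apply/allpairsPdep; exists d, c.
- by apply: pairwise_sep2_allpairs => [|d]; apply: cells_sep; [exact: gt.1|exact: (gs d).1].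
Qed.

Lemma grid_exists (es : seq (\bar R)) :
  exists2 s, grid s & forall e, e \in es -> e \in -oo%E :: s.
Proof.
pose s := sort <=%O (undup [seq x <- +oo%E :: es | x != -oo%E]).
have sin x : (x \in s) = (x != -oo%E) && ((x == +oo%E) || (x \in es)).
  by rewrite mem_sort mem_undup mem_filter inE.
exists s; last by move=> e ees; rewrite inE sin ees orbT andbT; case: eqP.
have sl : sorted <%O s.
  by rewrite lt_sorted_uniq_le sort_uniq undup_uniq/= sort_le_sorted.
have ps : path <%O (-oo)%E s.
  rewrite path_sortedE; last exact: lt_trans.
  by rewrite sl andbT; apply/allP => x; rewrite sin ltNye => /andP[].
split=> //.
have : +oo%E \in s by rewrite sin eqxx.
move: ps => /[swap] /splitPr[s1 [|x s2]]; first by rewrite last_cat.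
by rewrite cat_path /= => /and4P[_ _]; rewrite ltNge leey.
Qed.

End Order.

(** * Riemann sums over grids and bounded variation *)

Arguments incr2 {R} g I : simpl never.

Section StieltjesSums.
Variable R : realType.
Implicit Types (a b x u : \bar R) (I J : \bar R * \bar R) (r : rect R).

Lemma cells_mem (x0 : \bar R) s c : c \in cells x0 s -> c.2 \in s.
Proof.
elim: s x0 => //= u s IH x0; rewrite cells_cons !inE => /predU1P[->|/IH ->].
  by rewrite eqxx.
by rewrite orbT.
Qed.

Lemma telescope_below (g : \bar R -> R) x0 s b : path <%O x0 s -> b \in x0 :: s ->
  g b - g x0 = \sum_(c <- cells x0 s | (c.2 <= b)%E) incr1 g c.
Proof.
elim: s x0 => [|u s IH] x0 /=.
  by rewrite mem_seq1 /cells /= => _ /eqP ->; rewrite big_nil subrr.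
move=> /andP[x0u us]; rewrite inE => /predU1P[->|bs].
  rewrite subrr big_seq_cond big1// => c /andP[/cells_mem cs cx0]; exfalso.
  have x0us : path <%O x0 (u :: s) by rewrite /= x0u.
  by have /allP/(_ _ cs) := order_path_min lt_trans x0us; rewrite /= ltNge cx0.
have ub : (u <= b)%E.
  move: bs; rewrite inE => /predU1P[->//|bs].
  by apply/ltW; exact: (allP (order_path_min lt_trans us)).
by rewrite cells_cons big_cons /= ub -IH// /incr1 /= addrCA -addrA addrC -!addrA; ring.
Qed.

(** A cell lies in [I] exactly when its right endpoint belongs to [I] in the
    half-open sense. *)
Lemma telescope1 (g : \bar R -> R) x0 s I : path <%O x0 s ->
  I.1 \in x0 :: s -> I.2 \in x0 :: s -> (I.1 <= I.2)%E ->
  incr1 g I = \sum_(c <- cells x0 s | hmem c.2 I) incr1 g c.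
Proof.
move=> ps I1 I2 I12.
have h := telescope_below g ps I2.
have -> : incr1 g I = (g I.2 - g x0) - (g I.1 - g x0) by rewrite /incr1; ring.
rewrite h (telescope_below g ps I1) (bigID (fun c => c.2 <= I.1)%E) /=.
rewrite (eq_bigl (fun c => (c.2 <= I.1)%E)); last first.
  by move=> c /=; case: (leP c.2 I.1) => h'; rewrite ?andbF// (le_trans h').
rewrite addrAC subrr add0r; apply: eq_bigl => c /=.
by rewrite /hmem andbC ltNge.
Qed.

(** The increment over a rectangle is an iterated one-variable increment, so that
    two-dimensional telescoping reduces to the one-dimensional one. *)
Lemma incr2E (g : \bar R * \bar R -> R) r :
  incr2 g r = incr1 (fun y => incr1 (fun x => g (x, y)) r.1) r.2.
Proof. by case: r => [[a b] [c d]]; rewrite /incr2 /incr1 /=; ring. Qed.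

Definition cells2 (s t : seq (\bar R)) : seq (rect R) :=
  [seq (c, d) | d <- cells -oo t, c <- cells -oo s].

Definition corner (r : rect R) : \bar R * \bar R := (r.1.2, r.2.2).

Lemma telescope2 (g : \bar R * \bar R -> R) s t r : grid s -> grid t ->
  r.1.1 \in -oo%E :: s -> r.1.2 \in -oo%E :: s -> (r.1.1 <= r.1.2)%E ->
  r.2.1 \in -oo%E :: t -> r.2.2 \in -oo%E :: t -> (r.2.1 <= r.2.2)%E ->
  incr2 g r = \sum_(k <- cells2 s t | hmem2 (corner k) r) incr2 g k.
Proof.
move=> gs gt r11 r12 r1 r21 r22 r2.
rewrite [RHS]big_mkcond /cells2 big_allpairs_dep /=.
rewrite incr2E (telescope1 _ gt.1 r21 r22 r2) big_mkcond; apply: eq_bigr => d _.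
have [dr|dr] := boolP (hmem d.2 r.2); last first.
  by rewrite big1// => c _; rewrite /hmem2 /= (negbTE dr) andbF.
have E y : incr1 (fun x => g (x, y)) r.1 =
    \sum_(c <- cells -oo s | hmem c.2 r.1) incr1 (fun x => g (x, y)) c.
  exact: (telescope1 (fun x => g (x, y)) gs.1 r11 r12 r1).
rewrite {1}/incr1 !E -sumrB big_mkcond; apply: eq_bigr => c _.
by rewrite /hmem2 /= dr andbT; case: ifP => // _; rewrite incr2E.
Qed.

(** A Riemann sum does not change much when each interval is cut into cells and
    the tag is replaced by a point of the cell: after exchanging the two sums, a
    cell [c] keeps only the term of the interval that contains it. *)
Lemma sum_cells_close (T : eqType) n (a : 'I_n -> R) (p : 'I_n -> T -> bool)
    (C : seq T) (D f : T -> R) (e : R) :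
  (forall c, c \in C -> exists2 i, p i c & forall j, p j c -> j = i) ->
  (forall i c, c \in C -> p i c -> `|a i - f c| <= e) ->
  `|\sum_(i < n) a i * \sum_(c <- C | p i c) D c - \sum_(c <- C) f c * D c|
    <= e * \sum_(c <- C) `|D c|.
Proof.
move=> ex ae.
under eq_bigr do rewrite mulr_sumr big_mkcond.
rewrite exchange_big -sumrB mulr_sumr.
apply: le_trans (ler_norm_sum _ _ _) _.
rewrite big_seq [leRHS]big_seq; apply: ler_sum => c cC.
have [i pic uni] := ex c cC.
rewrite (bigD1 i)//= pic big1 ?addr0; last first.
  by move=> j ji; case: ifP => // /uni jE; rewrite jE eqxx in ji.
by rewrite -mulrBl normrM ler_wpM2r// ae.
Qed.

Lemma cells_gt s (c : \bar R * \bar R) : grid s -> c \in cells -oo s -> (-oo < c.2)%E.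
Proof. by move=> gs /(cells_lt gs.1)[_ h]; apply: le_lt_trans h; rewrite leNye. Qed.

Lemma division1_sum_close n (I : 'I_n -> \bar R * \bar R) (a : 'I_n -> R)
    (g f : \bar R -> R) s (e : R) : division1 I -> grid s ->
  (forall i, (I i).1 \in -oo%E :: s /\ (I i).2 \in -oo%E :: s) ->
  (forall i x, itv1 (I i) x -> `|a i - f x| <= e) ->
  `|\sum_(i < n) a i * incr1 g (I i) -
    \sum_(c <- cells -oo s) f c.2 * incr1 g c|
    <= e * \sum_(c <- cells -oo s) `|incr1 g c|.
Proof.
move=> dI gs Is ae.
under eq_bigr => i _.
  rewrite (telescope1 g gs.1 (Is i).1 (Is i).2); last by have [lI _ _] := dI; exact/ltW/lI.
  over.
apply: (@sum_cells_close _ _ a (fun i c => hmem c.2 (I i)) _ _ (fun c => f c.2)).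
  by move=> c cs; apply: division1_hmem => //; exact: cells_gt cs.
by move=> i c _ /hmem_itv; exact: ae.
Qed.

Lemma division2_sum_close n (I : 'I_n -> rect R) (a : 'I_n -> R)
    (g f : \bar R * \bar R -> R) s t (e : R) : division2 I -> grid s -> grid t ->
  (forall i, (I i).1.1 \in -oo%E :: s /\ (I i).1.2 \in -oo%E :: s) ->
  (forall i, (I i).2.1 \in -oo%E :: t /\ (I i).2.2 \in -oo%E :: t) ->
  (forall i z, itv2 (I i) z -> `|a i - f z| <= e) ->
  `|\sum_(i < n) a i * incr2 g (I i) -
    \sum_(k <- cells2 s t) f (corner k) * incr2 g k|
    <= e * \sum_(k <- cells2 s t) `|incr2 g k|.
Proof.
move=> dI gs gt Is It ae; have [lI _ _] := dI.
under eq_bigr => i _.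
  rewrite (telescope2 g gs gt (Is i).1 (Is i).2 (ltW (lI i).1) (It i).1 (It i).2 (ltW (lI i).2)).
  over.
apply: (@sum_cells_close _ _ a (fun i k => hmem2 (corner k) (I i)) _ _ (fun k => f (corner k))).
  move=> _ /allpairsPdep[d [c [dt cs ->]]].
  by apply: division2_hmem => //=; [exact: cells_gt cs|exact: cells_gt dt].
by move=> i k _ /hmem2_itv; exact: ae.
Qed.

Lemma ereal_sup_lty_bound (A : set (\bar R)) : (ereal_sup A < +oo)%E ->
  exists V : R, 0 <= V /\ forall v : R, A v%:E -> v <= V.
Proof.
move=> Aoo; exists (Num.max 0 (fine (ereal_sup A))); split.
  by rewrite le_max lexx.
move=> v Av; have := ereal_sup_ubound Av; rewrite le_max.
case: (ereal_sup A) Aoo => //= r _.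
by rewrite lee_fin => ->; rewrite orbT.
Qed.

Definition bounded_cells1 (g : \bar R -> R) (V : R) :=
  forall s, grid s -> \sum_(c <- cells -oo s) `|incr1 g c| <= V.

Definition bounded_cells2 (g : \bar R * \bar R -> R) (V : R) :=
  forall s t, grid s -> grid t -> \sum_(k <- cells2 s t) `|incr2 g k| <= V.

Lemma var1_cells g : (var1 g < +oo)%E -> exists2 V, 0 <= V & bounded_cells1 g V.
Proof.
move=> /ereal_sup_lty_bound[V [V0 hV]]; exists V => // s gs; apply: hV.
exists _, (tnth (in_tuple (cells -oo s))); split; first exact: grid_division1.
by congr _%:E; rewrite (big_tnth _ _ (cells -oo s)).
Qed.

Lemma var12_cells g : (var12 g < +oo)%E -> exists2 V, 0 <= V & bounded_cells2 g V.
Proof.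
move=> /ereal_sup_lty_bound[V [V0 hV]]; exists V => // s t gs gt; apply: hV.
exists _, (tnth (in_tuple (cells2 s t))); split.
  exact: (@grid_division2 R t (fun=> s)).
by congr _%:E; rewrite (big_tnth _ _ (cells2 s t)).
Qed.

Lemma bounded_cells_swap (g : \bar R * \bar R -> R) V :
  bounded_cells2 g V -> bounded_cells2 (fun z => g (z.2, z.1)) V.
Proof.
move=> gV s t gs gt; apply: le_trans (gV t s gt gs).
rewrite /cells2 !big_allpairs_dep exchange_big /=.
rewrite le_eqVlt; apply/orP; left; apply/eqP.
apply: eq_bigr => c _; apply: eq_bigr => d _.
by case: c d => [? ?] [? ?]; congr `|_|; rewrite /incr2 /=; ring.
Qed.

(** On a cell, the increments of [g] along the lines at heights +oo and [y0] differ
    by the increment of [g] over the rectangle in between; these rectangles are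
    unions of cells of a grid through [y0]. *)
Lemma bounded_cells_line (g : \bar R * \bar R -> R) (y0 : \bar R) (V W : R) :
  bounded_cells2 g V -> bounded_cells1 (fun x => g (x, y0)) W ->
  bounded_cells1 (fun x => g (x, +oo%E)) (V + W).
Proof.
move=> gV gW s gs.
have [t gt ht] := grid_exists [:: y0].
have yt : y0 \in -oo%E :: t by apply: ht; rewrite mem_head.
have oot : +oo%E \in -oo%E :: t by rewrite -gt.2 mem_last.
apply: (@le_trans _ _ (\sum_(c <- cells -oo s)
  (\sum_(d <- cells -oo t) `|incr2 g (c, d)| + `|incr1 (fun x => g (x, y0)) c|))).
  apply: ler_sum => c _.
  have -> : incr1 (fun x => g (x, +oo%E)) c =
      incr2 g (c, (y0, +oo%E)) + incr1 (fun x => g (x, y0)) c.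
    by case: c => ? ?; rewrite /incr1 /incr2 /=; ring.
  apply: le_trans (ler_normD _ _) _; rewrite lerD2r.
  rewrite incr2E (telescope1 _ gt.1)//= ?leey//.
  apply: le_trans (ler_norm_sum _ _ _) _.
  rewrite big_mkcond; apply: ler_sum => d _.
  by case: ifP => // _; rewrite ?normr_ge0// incr2E.
rewrite big_split/=; apply: lerD; last exact: gW.
apply: le_trans (gV s t gs gt).
by rewrite /cells2 big_allpairs_dep exchange_big.
Qed.

End StieltjesSums.

(** * Limits along gauges and fine divisions *)

Section GaugeLimit.
Variables (R : realType) (G : Type) (ok : set G) (inter : G -> G -> G).
Variable S : G -> set R.
Hypothesis ok_ex : exists g, ok g.
Hypothesis ok_inter : forall g h, ok g -> ok h -> ok (inter g h).
Hypothesis S_inter : forall g h, S (inter g h) `<=` S g `&` S h.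
Hypothesis S_nonempty : forall g, ok g -> S g !=set0.

(** The sums over fine divisions form a filter base as the gauge shrinks.  The
    integral is the limit of that filter; both dimensions share this argument. *)
Definition gauge_limit (A : R) := forall e : R, 0 < e ->
  exists2 g, ok g & forall v, S g v -> `|v - A| < e.

Let F : set_system R := filter_from ok S.

Let F_proper : ProperFilter F.
Proof.
apply: filter_from_proper => //; apply: filter_from_filter => // g h og oh.
by exists (inter g h); [exact: ok_inter|exact: S_inter].
Qed.

Lemma gauge_limit_exists :
  (forall e : R, 0 < e -> exists2 g, ok g & forall v w, S g v -> S g w -> `|v - w| < e) ->
  exists A, gauge_limit A.
Proof.
move=> cauchyS; have FP := F_proper; have cF : cvg F.
  apply: cauchy_cvg; apply/cauchy_exP => e e0.
  have [g og gS] := cauchyS e e0; have [v gv] := S_nonempty og.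
  by exists v, g => // w gw; exact: gS.
exists (lim F) => e e0.
have : F (ball (lim F) e) by apply: cF; exact: nbhsx_ballx.
by move=> [g og gS]; exists g => // v /gS; rewrite /ball /= distrC.
Qed.

Lemma gauge_limit_unique A B : gauge_limit A -> gauge_limit B -> A = B.
Proof.
move=> hA hB; apply/eqP/negPn/negP => AB.
have e0 : 0 < `|A - B| / 2 by rewrite divr_gt0// normr_gt0 subr_eq0.
have [g og gA] := hA _ e0; have [h oh hB'] := hB _ e0.
have [v ghv] := S_nonempty (ok_inter og oh); have [gv hv] := S_inter ghv.
have := ltrD (gA _ gv) (hB' _ hv); rewrite -splitr ltNge => /negP; apply.
rewrite -[A - B]opprK opprB -[_ - _](_ : B - v + (v - A) = _); last by ring.
by rewrite normrN addrC (le_trans (ler_normD _ _))// lerD2l distrC.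
Qed.

End GaugeLimit.

Section Cousin.
Variable R : realType.
Implicit Types (a b x u : \bar R).

(** Neighbourhoods contain a segment around the point, which is one-sided only at
    the ends of the extended line. *)
Lemma nbhs_ereal_segment x (A : set (\bar R)) : nbhs x A ->
  exists l r, [/\ (l <= x <= r)%E, x = -oo%E \/ (l < x)%E, x = +oo%E \/ (x < r)%E &
    forall y, (l <= y <= r)%E -> A y].
Proof.
case: x => [x| |] /=.
- rewrite -[nbhs _ A]/(nbhs x (fun y : R => A y%:E)) => /nbhs_ballP[e /= e0 eA].
  have e2 : 0 < e / 2 by rewrite divr_gt0.
  exists (x - e / 2)%:E, (x + e / 2)%:E; split.
  + by rewrite !lee_fin gerBl lerDl ltW.
  + by right; rewrite lte_fin gtrBl.
  + by right; rewrite lte_fin ltrDl.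
  + move=> [y| |]; rewrite ?leNgt ?ltNyr ?ltry ?andbF// -!leNgt !lee_fin => xy.
    apply: eA; rewrite /ball /= ltr_distlC; move: xy => /andP[? ?].
    by apply/andP; split; lra.
- move=> [M [_ MA]]; exists (M + 1)%:E, +oo%E; split; rewrite ?leey//.
  + by right; rewrite ltry.
  + by left.
  + by move=> y /andP[My _]; apply: MA; apply: lt_le_trans My; rewrite lte_fin ltrDl.
- move=> [M [_ MA]]; exists -oo%E, (M - 1)%:E; split; rewrite ?leNye ?lexx//.
  + by left.
  + by right; rewrite ltNyr.
  + by move=> y /andP[_ yM]; apply: MA; apply: le_lt_trans yM _; rewrite lte_fin gtrDl ltrN10.
Qed.

Definition fine_chain (N : \bar R -> set (\bar R)) (a : \bar R) (s : seq (\bar R)) :=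
  path <%O a s /\
  forall c, c \in cells a s -> exists t, itv1 c t /\ itv1 c `<=` N t.

Lemma fine_chain_rcons N a s b t : fine_chain N a s -> (last a s < b)%E ->
  itv1 (last a s, b) t -> itv1 (last a s, b) `<=` N t ->
  fine_chain N a (rcons s b).
Proof.
move=> [ps hs] lb tb tN; split; first by rewrite rcons_path ps.
move=> c; rewrite -cats1 cells_cat mem_cat => /orP[/hs//|].
by rewrite /cells /= mem_seq1 => /eqP ->; exists t.
Qed.

(** Let [m] be the supremum of the points that can be reached from -oo by a fine
    chain of intervals.  A single interval tagged [m] leads from a reachable point
    just below [m] to any point of a segment around [m], so [m] is reachable and
    cannot be smaller than +oo. *)
Lemma cousin1 (N : \bar R -> set (\bar R)) : (forall x, nbhs x (N x)) ->
  exists2 s, grid s & forall c, c \in cells -oo s -> exists t, itv1 c t /\ itv1 c `<=` N t.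
Proof.
move=> hN; pose E : set (\bar R) := [set x | (-oo < x)%E /\
  exists2 s, fine_chain N -oo s & last -oo%E s = x].
suff [_ [s [ps hs] ls]] : E +oo%E by exists s.
pose m := ereal_sup E.
have [l0 [r0 [/andP[l0m mr0] _ [//|r0m] N0]]] := nbhs_ereal_segment (hN -oo%E).
have Er0 : E r0.
  split=> //; exists [:: r0] => //.
  apply: (@fine_chain_rcons _ _ [::] _ -oo%E) => //=.
  by move=> y; rewrite /itv1/= in_itv/= => /andP[_ yr]; apply: N0; rewrite yr (le_trans l0m)// leNye.
have r0m' : (r0 <= m)%E by exact: ereal_sup_ubound.
have m0 : (-oo < m)%E by exact: lt_le_trans r0m r0m'.
have [l [r [/andP[lm mr] [mE|lm'] rm Nlr]]] := nbhs_ereal_segment (hN m).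
  by rewrite mE ltxx in m0.
have [x Ex lx] : exists2 x, E x & (l < x)%E by exact: ereal_sup_gt.
have xm : (x <= m)%E by exact: ereal_sup_ubound.
have Ey y : (m <= y <= r)%E -> E y.
  move=> /andP[my yr]; case: (ltP x y) => [xy|yx]; last first.
    by rewrite (_ : y = x)//; apply/le_anti; rewrite yx (le_trans xm).
  have [x0 [s fs ls]] := Ex; split; first exact: lt_trans xy.
  exists (rcons s y); last by rewrite last_rcons.
  apply: (@fine_chain_rcons _ _ _ _ m) => //; rewrite ls//.
    by rewrite /itv1/= in_itv/= xm.
  move=> z; rewrite /itv1/= in_itv/= => /andP[xz zy].
  by apply: Nlr; rewrite (le_trans (ltW lx) xz) (le_trans zy).
case: rm => [moo|rm]; first by rewrite -moo; apply: Ey; rewrite lexx.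
have Er : E r by apply: Ey; rewrite mr lexx.
by have := ereal_sup_ubound Er; rewrite leNgt rm.
Qed.

(** For each [y], a fine division of the line at height [y] works on a whole strip
    around [y], because it has finitely many tags.  A division of the second axis
    that is fine for these strips selects the heights to be used. *)
Lemma cousin2 (N : \bar R * \bar R -> set (\bar R * \bar R)) :
  (forall z, nbhs z (N z)) ->
  exists (n : nat) (I : 'I_n -> rect R), division2 I /\
    forall i, exists z, itv2 (I i) z /\ itv2 (I i) `<=` N z.
Proof.
move=> hN.
have slice y : exists p : seq (\bar R) * set (\bar R), [/\ grid p.1, nbhs y p.2 &
    forall c, c \in cells -oo p.1 -> exists t, itv1 c t /\ itv1 c `*` p.2 `<=` N (t, y)].
  have /choice[UV hUV] x : exists UV : set (\bar R) * set (\bar R),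
      [/\ nbhs x UV.1, nbhs y UV.2 & UV.1 `*` UV.2 `<=` N (x, y)].
    by have [[U V] [/= nU nV] UVN] := hN (x, y); exists (U, V).
  have [s gs hs] := @cousin1 (fun x => (UV x).1) (fun x => let: And3 h _ _ := hUV x in h).
  suff [V nV hV] : exists2 V, nbhs y V & forall c, c \in cells -oo s ->
      exists t, itv1 c t /\ itv1 c `*` V `<=` N (t, y) by exists (s, V).
  elim: (cells -oo s) hs => [|c cs IH] hs; first by exists setT => //; exact: filterT.
  have [|V nV hV] := IH; first by move=> c' c'cs; apply: hs; rewrite inE c'cs orbT.
  have [t [ct cU]] := hs c (mem_head _ _); have [_ nVt UVN] := hUV t.
  exists (V `&` (UV t).2); first exact: filterI.
  move=> c'; rewrite inE => /predU1P[->|/hV[t' [ct' cV]]].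
    by exists t; split=> // -[u v] [/= cu [_ Vv]]; apply: UVN; split=> //; exact: cU.
  by exists t'; split=> // -[u v] [/= cu [Vv _]]; exact: cV.
have /choice[sV hsV] := slice.
have [t gt ht] := @cousin1 (fun y => (sV y).2) (fun x => let: And3 _ h _ := hsV x in h).
have /choice[ty hty] d : exists y, d \in cells -oo t -> itv1 d y /\ itv1 d `<=` (sV y).2.
  by have [/ht[y hy]|nd] := boolP (d \in cells -oo t); [exists y|exists 0%E].
exists _, (tnth (in_tuple [seq (c, d) | d <- cells -oo t, c <- cells -oo (sV (ty d)).1])).
split; first by apply: grid_division2 => // d; have [] := hsV (ty d).
move=> i; have /allpairsPdep[d [c [dt cs ->]]] := mem_tnth i (in_tuple _).
have [dy dV] := hty d dt; have [_ _ /(_ c cs)[x [cx cN]]] := hsV (ty d).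
exists (x, ty d); split; first by split.
by move=> [u v] [/= cu dv]; apply: cN; split=> //; exact: dV.
Qed.

End Cousin.

(** * Existence and additivity of the Stieltjes integrals *)

Section StieltjesIntegrals.
Variable R : realType.

Definition sums1 (F g : \bar R -> R) gam : set R := [set v |
  exists n (I : 'I_n -> \bar R * \bar R) t, Defs.fine1 gam I t /\
    v = \sum_(i < n) F (t i) * incr1 g (I i)].

Definition sums2 (F g : \bar R * \bar R -> R) gam : set R := [set v |
  exists n (I : 'I_n -> rect R) t, fine2 gam I t /\
    v = \sum_(i < n) F (t i) * incr2 g (I i)].

Lemma is_hs1E F g A : is_hs1 F g A <-> gauge_limit (@gauge1 R) (sums1 F g) A.
Proof.
split=> h e /h[gam ggam hgam]; exists gam => //.
  by move=> _ [n [I [t [fI ->]]]]; exact: hgam.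
by move=> n I t fI; apply: hgam; exists n, I, t.
Qed.

Lemma is_hs2E F g A : is_hs2 F g A <-> gauge_limit (@gauge2 R) (sums2 F g) A.
Proof.
split=> h e /h[gam ggam hgam]; exists gam => //.
  by move=> _ [n [I [t [fI ->]]]]; exact: hgam.
by move=> n I t fI; apply: hgam; exists n, I, t.
Qed.

Definition ginter (T : Type) (gam gam' : T -> set T) (x : T) := gam x `&` gam' x.

(** A gauge must assign subsets of the real line to real points; there is no such
    restriction at the points at infinity. *)
Definition real_nbhd (x : \bar R) : set (\bar R) :=
  if x \is a fin_num then range (@EFin R) else setT.

Lemma open_range_EFin : open (range (@EFin R)).
Proof.
have -> : range (@EFin R) = [set x | (-oo < x)%E] `&` [set x | (x < +oo)%E].
  apply/seteqP; split=> [_ [x _ <-]|[x| |] [//= _ _]]; first by rewrite /= ltNyr ltry.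
  by exists x.
by apply: openI; [exact: open_ereal_gt_ereal|exact: open_ereal_lt_ereal].
Qed.

Lemma open_real_nbhd x : open (real_nbhd x) /\ real_nbhd x x.
Proof.
rewrite /real_nbhd; case: ifPn => [xfin|_]; last by split => //; exact: openT.
by split; [exact: open_range_EFin|exists (fine x); rewrite ?fineK].
Qed.

Lemma real_nbhd_fin (x : R) : real_nbhd x%:E = range (@EFin R).
Proof. by []. Qed.

Lemma open_setX (T U : topologicalType) (A : set T) (B : set U) :
  open A -> open B -> open (A `*` B).
Proof.
move=> oA oB; rewrite openE => -[a b] [/= Aa Bb].
by exists (A, B); [split; apply: open_nbhs_nbhs|].
Qed.

Lemma gauge1_ex : exists gam, @gauge1 R gam.
Proof.
by exists real_nbhd; split=> [x|x]; [exact: open_real_nbhd|rewrite real_nbhd_fin].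
Qed.

Lemma gauge2_ex : exists gam, @gauge2 R gam.
Proof.
exists (fun z => real_nbhd z.1 `*` real_nbhd z.2); split=> [z|x y]; last first.
  by rewrite /= !real_nbhd_fin.
have [p1 z1] := open_real_nbhd z.1; have [p2 z2] := open_real_nbhd z.2.
by split; [exact: open_setX|].
Qed.

Lemma gauge1_inter gam gam' : @gauge1 R gam -> gauge1 gam' -> gauge1 (ginter gam gam').
Proof.
move=> [g1 g2] [h1 h2]; split=> [x|x y [/g2//]].
have [??] := g1 x; have [??] := h1 x.
by split; [exact: openI|].
Qed.

Lemma gauge2_inter gam gam' : @gauge2 R gam -> gauge2 gam' -> gauge2 (ginter gam gam').
Proof.
move=> [g1 g2] [h1 h2]; split=> [x|x y z [/g2//]].
have [??] := g1 x; have [??] := h1 x.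
by split; [exact: openI|].
Qed.

Lemma fine1_inter gam gam' n (I : 'I_n -> \bar R * \bar R) t :
  Defs.fine1 (ginter gam gam') I t -> Defs.fine1 gam I t /\ Defs.fine1 gam' I t.
Proof.
move=> [dI hI]; split; split=> // i; have [ti It] := hI i; split=> // x /It[]//.
Qed.

Lemma fine2_inter gam gam' n (I : 'I_n -> rect R) t :
  fine2 (ginter gam gam') I t -> fine2 gam I t /\ fine2 gam' I t.
Proof.
move=> [dI hI]; split; split=> // i; have [ti It] := hI i; split=> // x /It[]//.
Qed.

Lemma sums1_inter F g gam gam' :
  sums1 F g (ginter gam gam') `<=` sums1 F g gam `&` sums1 F g gam'.
Proof.
by move=> _ [n [I [t [/fine1_inter[f1 f2] ->]]]]; split; exists n, I, t.
Qed.

Lemma sums2_inter F g gam gam' :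
  sums2 F g (ginter gam gam') `<=` sums2 F g gam `&` sums2 F g gam'.
Proof.
by move=> _ [n [I [t [/fine2_inter[f1 f2] ->]]]]; split; exists n, I, t.
Qed.

Lemma fine1_ex gam : @gauge1 R gam ->
  exists n (I : 'I_n -> \bar R * \bar R) t, Defs.fine1 gam I t.
Proof.
move=> [og _]; have [x|s gs hs] := @cousin1 R gam.
  by have [??] := og x; exact: open_nbhs_nbhs.
have /choice[t ht] i : exists t, itv1 (tnth (in_tuple (cells -oo s)) i) t /\
    itv1 (tnth (in_tuple (cells -oo s)) i) `<=` gam t.
  by apply: hs; exact: mem_tnth.
by exists _, (tnth (in_tuple (cells -oo s))), t; split; [exact: grid_division1|].
Qed.

Lemma fine2_ex gam : @gauge2 R gam ->
  exists n (I : 'I_n -> rect R) t, fine2 gam I t.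
Proof.
move=> [og _]; have [z|n [I [dI /choice[t ht]]]] := @cousin2 R gam.
  by have [??] := og z; exact: open_nbhs_nbhs.
by exists n, I, t.
Qed.

Lemma sums1_nonempty F g gam : gauge1 gam -> sums1 F g gam !=set0.
Proof. by move=> /fine1_ex[n [I [t f]]]; eexists; exists n, I, t; split. Qed.

Lemma sums2_nonempty F g gam : gauge2 gam -> sums2 F g gam !=set0.
Proof. by move=> /fine2_ex[n [I [t f]]]; eexists; exists n, I, t; split. Qed.

Lemma is_hs1_unique F g A B : @is_hs1 R F g A -> is_hs1 F g B -> A = B.
Proof.
move=> /is_hs1E hA /is_hs1E hB.
by apply: (gauge_limit_unique gauge1_inter (@sums1_inter F g) (@sums1_nonempty F g) hA hB).
Qed.

Lemma is_hs2_unique F g A B : @is_hs2 R F g A -> is_hs2 F g B -> A = B.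
Proof.
move=> /is_hs2E hA /is_hs2E hB.
by apply: (gauge_limit_unique gauge2_inter (@sums2_inter F g) (@sums2_nonempty F g) hA hB).
Qed.

Lemma hs1E F g A : @is_hs1 R F g A -> hs1 F g = A.
Proof. by move=> hA; apply: xget_unique => // B hB; exact: is_hs1_unique hA. Qed.

Lemma hs2E F g A : @is_hs2 R F g A -> hs2 F g = A.
Proof. by move=> hA; apply: xget_unique => // B hB; exact: is_hs2_unique hA. Qed.

Lemma is_hs1B F G g A B : @is_hs1 R F g A -> is_hs1 G g B -> is_hs1 (F - G) g (A - B).
Proof.
move=> hA hB e e0; have e2 : 0 < e / 2 by rewrite divr_gt0.
have [gam gg hg] := hA _ e2; have [gam' gg' hg'] := hB _ e2.
exists (ginter gam gam'); first exact: gauge1_inter.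
move=> n I t /fine1_inter[f f']; rewrite (splitr e).
under eq_bigr do rewrite !fctE mulrBl.
rewrite sumrB [X in `|X|](_ : _ = (\sum_(i < n) F (t i) * incr1 g (I i) - A) -
  (\sum_(i < n) G (t i) * incr1 g (I i) - B)); last by ring.
by apply: le_lt_trans (ler_normB _ _) _; apply: ltrD; [exact: hg|exact: hg'].
Qed.

Lemma is_hs2B F G g A B : @is_hs2 R F g A -> is_hs2 G g B -> is_hs2 (F - G) g (A - B).
Proof.
move=> hA hB e e0; have e2 : 0 < e / 2 by rewrite divr_gt0.
have [gam gg hg] := hA _ e2; have [gam' gg' hg'] := hB _ e2.
exists (ginter gam gam'); first exact: gauge2_inter.
move=> n I t /fine2_inter[f f']; rewrite (splitr e).
under eq_bigr do rewrite !fctE mulrBl.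
rewrite sumrB [X in `|X|](_ : _ = (\sum_(i < n) F (t i) * incr2 g (I i) - A) -
  (\sum_(i < n) G (t i) * incr2 g (I i) - B)); last by ring.
by apply: le_lt_trans (ler_normB _ _) _; apply: ltrD; [exact: hg|exact: hg'].
Qed.

Lemma open_osc (T : topologicalType) (F : T -> R) (z : T) (e : R) : continuous F ->
  open [set w | `|F z - F w| < e].
Proof.
move=> cF; apply: (@open_comp _ _ F [set y : R | `|F z - y| < e]) => [w _|].
  exact: cF.
exact: ball_open.
Qed.

(** The oscillation allowed on an interval is [e / (2 * (V + 1))]; adding 1 to the
    variation [V] avoids dividing by 0. *)
Lemma close_bound (S S' C e V : R) : 0 < e -> 0 <= V ->
  `|S - C| <= e / (2 * (V + 1)) * V -> `|S' - C| <= e / (2 * (V + 1)) * V ->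
  `|S - S'| < e.
Proof.
move=> e0 V0 h h'; have V1 : 0 < V + 1 by rewrite ltr_wpDl.
rewrite (_ : S - S' = (S - C) - (S' - C)); last by ring.
apply: le_lt_trans (ler_normB _ _) _; apply: le_lt_trans (lerD h h') _.
have -> : e / (2 * (V + 1)) * V + e / (2 * (V + 1)) * V = e * (V / (V + 1)).
  by field; rewrite gt_eqF.
by rewrite gtr_pMr// ltr_pdivrMr// mul1r ltrDl.
Qed.

(** Two divisions that are fine for the gauge given by the continuity of [F] are both
    compared with the sum over a grid through all their endpoints. *)
Lemma hs1_exists F g V : continuous F -> 0 <= V -> @bounded_cells1 R g V ->
  exists A, is_hs1 F g A.
Proof.
move=> cF V0 gV; suff [A hA] : exists A, gauge_limit (@gauge1 R) (sums1 F g) A.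
  by exists A; exact/is_hs1E.
apply: (gauge_limit_exists gauge1_ex gauge1_inter (@sums1_inter F g) (@sums1_nonempty F g)).
move=> e e0; have V1 : 0 < 2 * (V + 1) by rewrite mulr_gt0// ltr_wpDl.
pose d := e / (2 * (V + 1)); have d0 : 0 < d by rewrite divr_gt0.
exists (fun x => [set y | `|F x - F y| < d] `&` real_nbhd x).
  split=> [x|x y [_]]; last by rewrite real_nbhd_fin.
  have [p1 x1] := open_real_nbhd x; split; first by apply: openI => //; exact: open_osc.
  by split=> //=; rewrite subrr normr0.
move=> _ _ [n [I [t [fI ->]]]] [m [J [u [fJ ->]]]].
have [s gs hs] := grid_exists
  ([seq (I i).1 | i <- enum 'I_n] ++ [seq (I i).2 | i <- enum 'I_n] ++
   [seq (J i).1 | i <- enum 'I_m] ++ [seq (J i).2 | i <- enum 'I_m]).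
have close k (K : 'I_k -> \bar R * \bar R) v :
    Defs.fine1 (fun x => [set y | `|F x - F y| < d] `&` real_nbhd x) K v ->
    (forall i, (K i).1 \in -oo%E :: s /\ (K i).2 \in -oo%E :: s) ->
    `|\sum_(i < k) F (v i) * incr1 g (K i) -
      \sum_(c <- cells -oo s) F c.2 * incr1 g c| <= d * V.
  move=> [dK fK] Ks.
  have := @division1_sum_close _ _ K (fun i => F (v i)) g F s d dK gs Ks.
  move=> h; apply: le_trans (h _) _; last by apply: ler_wpM2l; [exact: ltW|exact: gV].
  by move=> i x /(fK i).2[/= /ltW].
have inm k (h : 'I_k -> \bar R) i : h i \in [seq h i | i <- enum 'I_k].
  by apply/mapP; exists i; rewrite ?mem_enum.
have SI : forall i, (I i).1 \in -oo%E :: s /\ (I i).2 \in -oo%E :: s.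
  by move=> i; split; apply: hs; rewrite !mem_cat inm ?orbT.
have SJ : forall i, (J i).1 \in -oo%E :: s /\ (J i).2 \in -oo%E :: s.
  by move=> i; split; apply: hs; rewrite !mem_cat inm ?orbT.
exact: close_bound e0 V0 (close _ _ _ fI SI) (close _ _ _ fJ SJ).
Qed.

Lemma hs2_exists F g V : continuous F -> 0 <= V -> @bounded_cells2 R g V ->
  exists A, is_hs2 F g A.
Proof.
move=> cF V0 gV; suff [A hA] : exists A, gauge_limit (@gauge2 R) (sums2 F g) A.
  by exists A; exact/is_hs2E.
apply: (gauge_limit_exists gauge2_ex gauge2_inter (@sums2_inter F g) (@sums2_nonempty F g)).
move=> e e0; have V1 : 0 < 2 * (V + 1) by rewrite mulr_gt0// ltr_wpDl.
pose d := e / (2 * (V + 1)); have d0 : 0 < d by rewrite divr_gt0.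
pose gam z := [set w | `|F z - F w| < d] `&` (real_nbhd z.1 `*` real_nbhd z.2).
exists gam.
  split=> [z|x y z [_]]; last by rewrite /= !real_nbhd_fin.
  have [p1 z1] := open_real_nbhd z.1; have [p2 z2] := open_real_nbhd z.2.
  split; first by apply: openI; [exact: open_osc|exact: open_setX].
  by split=> //=; rewrite subrr normr0.
move=> _ _ [n [I [t [fI ->]]]] [m [J [u [fJ ->]]]].
have [s gs hs] := grid_exists
  ([seq (I i).1.1 | i <- enum 'I_n] ++ [seq (I i).1.2 | i <- enum 'I_n] ++
   [seq (J i).1.1 | i <- enum 'I_m] ++ [seq (J i).1.2 | i <- enum 'I_m]).
have [s' gs' hs'] := grid_exists
  ([seq (I i).2.1 | i <- enum 'I_n] ++ [seq (I i).2.2 | i <- enum 'I_n] ++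
   [seq (J i).2.1 | i <- enum 'I_m] ++ [seq (J i).2.2 | i <- enum 'I_m]).
have close k (K : 'I_k -> rect R) v : fine2 gam K v ->
    (forall i, (K i).1.1 \in -oo%E :: s /\ (K i).1.2 \in -oo%E :: s) ->
    (forall i, (K i).2.1 \in -oo%E :: s' /\ (K i).2.2 \in -oo%E :: s') ->
    `|\sum_(i < k) F (v i) * incr2 g (K i) -
      \sum_(c <- cells2 s s') F (corner c) * incr2 g c| <= d * V.
  move=> [dK fK] Ks Ks'.
  have := @division2_sum_close _ _ K (fun i => F (v i)) g F s s' d dK gs gs' Ks Ks'.
  move=> h; apply: le_trans (h _) _; last by apply: ler_wpM2l; [exact: ltW|exact: gV].
  by move=> i x /(fK i).2[/= /ltW].
have inm k (h : 'I_k -> \bar R) i : h i \in [seq h i | i <- enum 'I_k].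
  by apply/mapP; exists i; rewrite ?mem_enum.
have SI : forall i, (I i).1.1 \in -oo%E :: s /\ (I i).1.2 \in -oo%E :: s.
  by move=> i; split; apply: hs; rewrite !mem_cat
    (inm _ (fun i => (I i).1.1), inm _ (fun i => (I i).1.2)) ?orbT.
have SJ : forall i, (J i).1.1 \in -oo%E :: s /\ (J i).1.2 \in -oo%E :: s.
  by move=> i; split; apply: hs; rewrite !mem_cat
    (inm _ (fun i => (J i).1.1), inm _ (fun i => (J i).1.2)) ?orbT.
have SI' : forall i, (I i).2.1 \in -oo%E :: s' /\ (I i).2.2 \in -oo%E :: s'.
  by move=> i; split; apply: hs'; rewrite !mem_cat
    (inm _ (fun i => (I i).2.1), inm _ (fun i => (I i).2.2)) ?orbT.
have SJ' : forall i, (J i).2.1 \in -oo%E :: s' /\ (J i).2.2 \in -oo%E :: s'.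
  by move=> i; split; apply: hs'; rewrite !mem_cat
    (inm _ (fun i => (J i).2.1), inm _ (fun i => (J i).2.2)) ?orbT.
exact: close_bound e0 V0 (close _ _ _ fI SI SI') (close _ _ _ fJ SJ SJ').
Qed.

(** The variation on the lines at +oo is controlled by the variation on some other
    line and the two-dimensional variation. *)
Lemma HKBV_bounded_cells (g : \bar R * \bar R -> R) : HKBV R g ->
  exists2 V : R, 0 <= V & [/\ bounded_cells2 g V,
    bounded_cells1 (fun s => g (s, +oo%E)) V &
    bounded_cells1 (fun t => g (+oo%E, t)) V].
Proof.
move=> [/var12_cells[V V0 gV] [x0 [y0 [/var1_cells[W W0 gW] /var1_cells[Z Z0 gZ]]]]].
exists (V + (W + Z)); first by rewrite !addr_ge0.
split=> [s t gs gt|s gs|t gt].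
- by apply: le_trans (gV s t gs gt) _; rewrite lerDl addr_ge0.
- apply: le_trans (bounded_cells_line gV gW gs) _.
  by rewrite addrA lerDl.
- have := bounded_cells_line (bounded_cells_swap gV) gZ gt => /le_trans; apply.
  by rewrite lerD2l lerDr.
Qed.

Definition stieltjes_parts (F g : \bar R * \bar R -> R) (A1 A2 A12 : R) :=
  [/\ is_hs1 (fun s => F (s, +oo%E)) (fun s => g (s, +oo%E)) A1,
      is_hs1 (fun t => F (+oo%E, t)) (fun t => g (+oo%E, t)) A2 &
      is_hs2 F g A12].

Lemma stieltjes_parts_exist (F g : \bar R * \bar R -> R) : continuous F -> HKBV R g ->
  exists A1 A2 A12, stieltjes_parts F g A1 A2 A12.
Proof.
move=> cF /HKBV_bounded_cells[V V0 [g2 g1 g1']].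
have [A1 hA1] : exists A, is_hs1 (fun s => F (s, +oo%E)) (fun s => g (s, +oo%E)) A.
  apply: (hs1_exists _ V0 g1) => x.
  by apply: continuous_comp; [exact: continuous_pairr|exact: cF].
have [A2 hA2] : exists A, is_hs1 (fun t => F (+oo%E, t)) (fun t => g (+oo%E, t)) A.
  apply: (hs1_exists _ V0 g1') => x.
  by apply: continuous_comp; [exact: continuous_pairl|exact: cF].
by have [A12 hA12] := hs2_exists cF V0 g2; exists A1, A2, A12.
Qed.

Lemma prod_integrableE (f : testfun R -> R) (g : \bar R * \bar R -> R) A1 A2 A12 :
  stieltjes_parts (primitive f) g A1 A2 A12 -> prod_integrable f g.
Proof. by move=> [? ? ?]; split; [exists A1|exists A2|exists A12]. Qed.

Lemma int_prodE (f : testfun R -> R) (g : \bar R * \bar R -> R) A1 A2 A12 :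
  stieltjes_parts (primitive f) g A1 A2 A12 ->
  int_prod f g = primitive f (+oo%E, +oo%E) * g (+oo%E, +oo%E) - A1 - A2 + A12.
Proof. by move=> [h1 h2 h12]; rewrite /int_prod (hs1E h1) (hs1E h2) (hs2E h12). Qed.

Lemma int_prodB (f f1 f2 : testfun R -> R) (g : \bar R * \bar R -> R) :
  continuous (primitive f1) -> continuous (primitive f2) ->
  primitive f = primitive f1 - primitive f2 -> HKBV R g ->
  [/\ prod_integrable f g, prod_integrable f1 g, prod_integrable f2 g &
      int_prod f g = int_prod f1 g - int_prod f2 g].
Proof.
move=> c1 c2 fE bg.
have [A1 [A2 [A12 hA]]] := stieltjes_parts_exist c1 bg.
have [B1 [B2 [B12 hB]]] := stieltjes_parts_exist c2 bg.
have hC : stieltjes_parts (primitive f) g (A1 - B1) (A2 - B2) (A12 - B12).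
  case: hA hB => [h1 h2 h12] [k1 k2 k12]; rewrite fE.
  by split; [exact: is_hs1B h1 k1|exact: is_hs1B h2 k2|exact: is_hs2B].
split; [exact: prod_integrableE hC|exact: prod_integrableE hA|exact: prod_integrableE hB|].
by rewrite (int_prodE hA) (int_prodE hB) (int_prodE hC) fE !fctE; ring.
Qed.

End StieltjesIntegrals.

(** * Integration of continuous functions on the plane *)

Section BoundedSupport.
Context d (T : measurableType d) (R : realType) (mu : {measure set T -> \bar R}).
Variables (D : set T) (h : T -> R) (M : R).
Hypotheses (mD : measurable D) (muD : (mu D < +oo)%E).
Hypotheses (mh : measurable_fun setT h) (hM : forall z, `|h z| <= M).
Hypothesis h0 : forall z, ~ D z -> h z = 0.

Let hD : h \_ D = h.
Proof.
by apply/funext => z; rewrite patchE; case: ifPn => // /negP zD; rewrite h0// => /mem_set.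
Qed.

Lemma bounded_supp_integrable_in : mu.-integrable D (EFin \o h).
Proof.
apply: measurable_bounded_integrable => //; first exact: measurable_funS mh.
exists M; split; first exact: num_real.
by move=> x Mx z _ /=; exact: le_trans (hM z) (ltW Mx).
Qed.

Lemma bounded_supp_integrable : mu.-integrable setT (EFin \o h).
Proof.
have := bounded_supp_integrable_in; rewrite integrable_mkcond//.
by rewrite restrict_EFin hD.
Qed.

Lemma bounded_supp_Rintegral : \int[mu]_z h z = \int[mu]_(z in D) h z.
Proof. by rewrite [RHS]Rintegral_mkcond hD. Qed.

Lemma bounded_supp_le : `|\int[mu]_z h z| <= M * fine (mu D).
Proof.
rewrite bounded_supp_Rintegral.
apply: le_trans (le_normr_Rintegral mD bounded_supp_integrable_in) _.
rewrite -Rintegral_cst//; apply: le_Rintegral => //.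
  have := integrable_abse bounded_supp_integrable_in.
  by apply: eq_integrable => // x _.
by apply: measurable_bounded_integrable => //; exact: bounded_cst.
Qed.

End BoundedSupport.

Section PlaneMeasure.
Variable R : realType.
Notation mu := (@lebesgue_measure R).
Notation mu2 := (lebesgue_measure \x lebesgue_measure)%E.
Notation plane := (measurableTypeR R * measurableTypeR R)%type.

Lemma rat_between (x e : R) : 0 < e -> exists a b : rat,
  ratr a < x < ratr b /\ forall y : R, ratr a < y < ratr b -> `|x - y| < e.
Proof.
move=> e0.
have [a] : exists q : rat, ratr q \in `]x - e, x[%R.
  by apply: rat_in_itvoo; rewrite gtrBl.
have [b] : exists q : rat, ratr q \in `]x, x + e[%R.
  by apply: rat_in_itvoo; rewrite ltrDl.
rewrite !in_itv/= => /andP[xb be] /andP[ea ax].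
exists a, b; split; first by rewrite ax xb.
by move=> y /andP[ay yb]; rewrite ltr_distlC; apply/andP; split; lra.
Qed.

(** An open set is the union of the rectangles with rational endpoints that it
    contains. *)
Lemma open_measurable2 (U : set (R * R)) : open U -> measurable (U : set plane).
Proof.
move=> oU.
pose box (a b c e : rat) : set (R * R) :=
  `]ratr a, ratr b[%classic `*` `]ratr c, ratr e[%classic.
pose A a b c e := if `[< box a b c e `<=` U >] then box a b c e else set0.
have -> : U = \bigcup_a \bigcup_b \bigcup_c \bigcup_e A a b c e.
  apply/seteqP; split=> [[x y] Uxy|z [a _ [b _ [c _ [e _]]]]]; last first.
    by rewrite /A; case: ifP => // /asboolP; apply.
  have /nbhs_ballP[r /= r0 rU] : nbhs (x, y) U by exact: open_nbhs_nbhs.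
  have [a [b [xab hab]]] := rat_between x r0.
  have [c [e [yce hce]]] := rat_between y r0.
  exists a => //; exists b => //; exists c => //; exists e => //.
  rewrite /A ifT; first by split; rewrite /= in_itv.
  apply/asboolP => -[u v] [/=]; rewrite !in_itv/= => uab vce.
  by apply: rU; split; [exact: hab|exact: hce].
apply: bigcupT_measurable_rat => a; apply: bigcupT_measurable_rat => b.
apply: bigcupT_measurable_rat => c; apply: bigcupT_measurable_rat => e.
rewrite /A; case: ifP => // _.
by apply: measurableX; exact: measurable_itv.
Qed.

Lemma continuous_measurable2 (h : R * R -> R) : continuous h ->
  measurable_fun setT (h : plane -> R).
Proof.
move=> ch; apply: (measurability (@RGenOInfty.G R)); first exact: RGenOInfty.measurableE.
move=> _ [_ [x ->] <-]; rewrite setTI.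
apply: open_measurable2; apply: open_comp => [z _|]; first exact: ch.
exact: interval_open.
Qed.

Definition square (a : R) : set (R * R) := `[- a, a]%classic `*` `[- a, a]%classic.

Lemma measurable_square a : measurable (square a : set plane).
Proof. by apply: measurableX; exact: measurable_itv. Qed.

Lemma square_measure a : (mu2 (square a) < +oo)%E.
Proof.
rewrite product_measure1E//; try exact: measurable_itv.
pose I : set R := `[- a, a]%classic.
have h : (mu I < +oo)%E.
  by rewrite /I lebesgue_measure_itv/=; case: ifP => //; rewrite -EFinB ltry.
apply: lte_mul_pinfty; [exact: measure_ge0| |exact: h].
by rewrite ge0_fin_numE; [exact: h|exact: measure_ge0].
Qed.

Lemma bounded_square (K : set (R * R)) : compact K -> exists a, K `<=` square a.
Proof.
move=> cK.
have bnd (f : R * R -> R) : continuous f -> exists a, forall z, K z -> `|f z| <= a.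
  move=> cf; have /compact_bounded[M [_ hM]] : compact (f @` K).
    by apply: continuous_compact cK; exact: continuous_subspaceT.
  by exists (M + 1) => z Kz; apply: (hM (M + 1)); [rewrite ltrDl|exists z].
have [a ha] := bnd fst (fun z => @cvg_fst _ _ _ _ _).
have [b hb] := bnd snd (fun z => @cvg_snd _ _ _ _ _).
exists (Num.max a b) => z Kz; split; rewrite /= in_itv/= -ler_norml le_max.
  by rewrite ha.
by rewrite hb ?orbT.
Qed.

End PlaneMeasure.

Section SupportedFunctions.
Variable R : realType.
Notation mu := (@lebesgue_measure R).
Notation mu2 := (lebesgue_measure \x lebesgue_measure)%E.
Implicit Types (h : R * R -> R) (f : R -> R) (a : R).

Definition supp_in a h := forall z, ~ square a z -> h z = 0.
Definition segment a : set R := `[- a, a]%classic.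
Definition supp_in1 a f := forall x, ~ segment a x -> f x = 0.

Lemma supp_in_bounded a h : continuous h -> supp_in a h -> exists M, forall z, `|h z| <= M.
Proof.
move=> ch sh; have : compact (h @` square a).
  apply: continuous_compact; first exact: continuous_subspaceT.
  by apply: compact_setX; exact: segment_compact.
move=> /compact_bounded[M [_ hM]]; exists (Num.max 0 (M + 1)) => z.
rewrite le_max; have [zs|/sh ->] := pselect (square a z); last by rewrite normr0 lexx.
by rewrite (hM (M + 1)) ?orbT ?ltrDl//; exists z.
Qed.

Lemma supp_in_integrable a h : continuous h -> supp_in a h ->
  mu2.-integrable setT (EFin \o h).
Proof.
move=> ch sh; have [M hM] := supp_in_bounded ch sh.
exact: (bounded_supp_integrable (measurable_square a) (square_measure a)
  (continuous_measurable2 ch) hM sh).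
Qed.

Lemma supp_in_le a h M : continuous h -> supp_in a h -> (forall z, `|h z| <= M) ->
  `|\int[mu2]_z h z| <= M * fine (mu2 (square a)).
Proof.
move=> ch sh hM.
exact: (bounded_supp_le (measurable_square a) (square_measure a) (continuous_measurable2 ch) hM sh).
Qed.

Lemma supp_in1_bounded a f : continuous f -> supp_in1 a f -> exists M, forall x, `|f x| <= M.
Proof.
move=> cf sf; have : compact (f @` segment a).
  by apply: continuous_compact; [exact: continuous_subspaceT|exact: segment_compact].
move=> /compact_bounded[M [_ hM]]; exists (Num.max 0 (M + 1)) => x.
rewrite le_max; have [xs|/sf ->] := pselect (segment a x); last by rewrite normr0 lexx.
by rewrite (hM (M + 1)) ?orbT ?ltrDl//; exists x.
Qed.

Lemma segment_measure a : (mu (segment a) < +oo)%E.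
Proof. by rewrite lebesgue_measure_itv/=; case: ifP => // _; rewrite -EFinB ltry. Qed.

Lemma supp_in1_integrable a f : continuous f -> supp_in1 a f ->
  mu.-integrable setT (EFin \o f).
Proof.
move=> cf sf; have [M hM] := supp_in1_bounded cf sf.
apply: (bounded_supp_integrable _ (segment_measure a) (continuous_measurable_fun cf) hM sf).
exact: measurable_itv.
Qed.

Lemma supp_in1_Rintegral a f : continuous f -> supp_in1 a f ->
  \int[mu]_x f x = \int[mu]_(x in segment a) f x.
Proof. by move=> cf sf; exact: bounded_supp_Rintegral. Qed.

Lemma supp_in_xsection a h x : supp_in a h -> supp_in1 a (fun y => h (x, y)).
Proof. by move=> sh y Ny; apply: sh => -[_]. Qed.

Lemma supp_in_ysection a h y : supp_in a h -> supp_in1 a (fun x => h (x, y)).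
Proof. by move=> sh x Nx; apply: sh => -[]. Qed.

Lemma continuous_xsection h x : continuous h -> continuous (fun y => h (x, y)).
Proof.
by move=> ch y; apply: continuous_comp; [exact: continuous_pairl|exact: ch].
Qed.

Lemma continuous_ysection h y : continuous h -> continuous (fun x => h (x, y)).
Proof.
by move=> ch x; apply: continuous_comp; [exact: continuous_pairr|exact: ch].
Qed.

Lemma supp_in_fubini12 a h : continuous h -> supp_in a h ->
  \int[mu2]_z h z = \int[mu]_x \int[mu]_y h (x, y).
Proof.
move=> ch sh; rewrite /Rintegral -integral12_prod_meas1; last exact: supp_in_integrable sh.
congr fine; apply: eq_integral => x _; rewrite /fubini_F /= fineK//.
apply: integrable_fin_num => //.
exact: (@supp_in1_integrable a _ (@continuous_xsection h x ch) (@supp_in_xsection a h x sh)).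
Qed.

Lemma supp_in_fubini21 a h : continuous h -> supp_in a h ->
  \int[mu2]_z h z = \int[mu]_y \int[mu]_x h (x, y).
Proof.
move=> ch sh; rewrite /Rintegral -integral21_prod_meas1; last exact: supp_in_integrable sh.
congr fine; apply: eq_integral => y _; rewrite /fubini_G /= fineK//.
apply: integrable_fin_num => //.
exact: (@supp_in1_integrable a _ (@continuous_ysection h y ch) (@supp_in_ysection a h y sh)).
Qed.

Lemma integral_derivative (a b : R) (f f' : R -> R) : a < b ->
  (forall x : R, is_derive x 1 f (f' x)) -> continuous f' ->
  \int[mu]_(x in `[a, b]) f' x = f b - f a.
Proof.
move=> ab df cf'.
have cf : continuous f.
  move=> x; apply/differentiable_continuous/derivable1_diffP.
  by have [] := df x.
rewrite /Rintegral (@continuous_FTC2 _ f' f)//.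
- exact: continuous_subspaceT.
- split.
  + by move=> x _; have [] := df x.
  + by apply: cvg_at_right_filter; exact: cf.
  + by apply: cvg_at_left_filter; exact: cf.
- by move=> x _; rewrite derive1E; exact: derive_val.
Qed.

(** A segment slightly larger than the support contains the support of the
    derivative, and the function vanishes at its endpoints. *)
Lemma integral_derivative0 a (f f' : R -> R) : 0 <= a -> supp_in1 a f ->
  (forall x : R, is_derive x 1 f (f' x)) -> continuous f' -> \int[mu]_x f' x = 0.
Proof.
move=> a0 sf df cf'.
have sf' : supp_in1 (a + 1) f'.
  move=> x Nx; have [fx dx] := df x; rewrite -dx.
  have -> : 'D_1 f x = 'D_1 (cst 0) x; last exact: derive_cst.
  apply: near_eq_derive; near=> y; apply: sf; rewrite /segment /= in_itv/= => yI.
  have : `|x - y| < 1 by near: y; exact: (nbhsx_ballx x 1 ltr01).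
  move=> xy; apply: Nx; rewrite /segment /= in_itv/=; move: yI xy => /andP[? ?].
  by rewrite ltr_distlC => /andP[? ?]; apply/andP; split; lra.
rewrite (supp_in1_Rintegral cf' sf') (integral_derivative _ df)//; last by lra.
by rewrite !sf ?subrr//; rewrite /segment /= in_itv/=; apply/negP;
  rewrite negb_and -!ltNge; apply/orP; [left|right]; lra.
Unshelve. all: by end_near. Qed.

End SupportedFunctions.

(** * Mixed derivatives as distributions *)

Section DistributionOfFunction.
Variable R : realType.
Notation mu := (@lebesgue_measure R).
Notation mu2 := (lebesgue_measure \x lebesgue_measure)%E.
Implicit Types (F G : \bar R * \bar R -> R) (phi psi : testfun R).

Lemma testfun_smooth phi : smooth phi.
Proof. by have /testfun_predP[] := testfunP phi. Qed.

Lemma testfun_continuous phi : continuous phi.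
Proof. exact: (testfun_smooth phi [::]).1. Qed.

Lemma support_in a (p : R * R -> R) : Defs.support p `<=` square a -> supp_in a p.
Proof.
move=> pa z Nz; apply/eqP/negP => /negP pz; apply: Nz; apply: pa.
exact: subset_closure.
Qed.

Lemma testfun_supp phi : exists a, Defs.support phi `<=` square a.
Proof. by have /testfun_predP[_ /bounded_square] := testfunP phi. Qed.

Lemma support_partial b (p : R * R -> R) : Defs.support (partial b p) `<=` Defs.support p.
Proof.
have -> : Defs.support p = closure (Defs.support p) by apply/closure_id; exact: closed_closure.
apply: closureS => z /= h; apply: contrapT => /partial_out pz.
by move: h; rewrite pz eqxx.
Qed.

Lemma test_partial_is_linear b (c : R) phi psi :
  test_partial b (c *: phi + psi) = c *: test_partial b phi + test_partial b psi.
Proof.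
by apply/val_inj; exact: (partials_lin [:: b] c (testfun_smooth phi) (testfun_smooth psi)).
Qed.

Definition test_partial12 phi := test_partial true (test_partial false phi).

Lemma test_partial12_is_linear (c : R) phi psi :
  test_partial12 (c *: phi + psi) = c *: test_partial12 phi + test_partial12 psi.
Proof. by rewrite /test_partial12 !test_partial_is_linear. Qed.

Lemma d12E F phi : d12 F phi = dist_of_fun F (test_partial12 phi).
Proof. by rewrite /d12 /dist_partial opprK. Qed.

Definition restrict_plane F (z : R * R) : R := F (z.1%:E, z.2%:E).

Lemma continuous_EFin : continuous (@EFin R : R -> \bar R).
Proof. by move=> x A. Qed.

Lemma continuous_restrict_plane F : continuous F -> continuous (restrict_plane F).
Proof.
move=> cF z; apply: (@continuous_comp _ _ _ (fun z : R * R => (z.1%:E, z.2%:E)) F); last exact: cF.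
exact: (@continuous_map_pair _ _ _ _ (@EFin R) (@EFin R) continuous_EFin continuous_EFin).
Qed.

Definition paired F (p : R * R -> R) (z : R * R) : R := restrict_plane F z * p z.

Lemma continuous_paired F p : continuous F -> continuous p -> continuous (paired F p).
Proof.
by move=> cF cp z; apply: continuousM; [exact: continuous_restrict_plane|exact: cp].
Qed.

Lemma supp_in_paired a F p : supp_in a p -> supp_in a (paired F p).
Proof. by move=> sp z Nz; rewrite /paired sp// mulr0. Qed.

Lemma paired_integrable F phi : continuous F ->
  mu2.-integrable setT (EFin \o paired F phi).
Proof.
move=> cF; have [a /support_in sa] := testfun_supp phi.
apply: (@supp_in_integrable _ a); first exact: continuous_paired (@testfun_continuous phi).
exact: supp_in_paired.
Qed.

Lemma dist_of_funE F phi : dist_of_fun F phi = \int[mu2]_z paired F phi z.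
Proof. by []. Qed.

Lemma dist_of_fun_lin_test F (c : R) phi psi : continuous F ->
  dist_of_fun F (c *: phi + psi) = c * dist_of_fun F phi + dist_of_fun F psi.
Proof.
move=> cF; rewrite !dist_of_funE -RintegralZl//; last exact: paired_integrable.
have ic : mu2.-integrable setT (EFin \o (fun z => c * paired F phi z)).
  have := integrableZl (measurableT) c (paired_integrable phi cF).
  by apply: eq_integrable.
rewrite -RintegralD//; last exact: paired_integrable.
by apply: eq_Rintegral => z _; rewrite /paired /=; rewrite !fctE /GRing.scale /=; ring.
Qed.

Lemma dist_of_fun_lin_fun F G (c : R) phi : continuous F -> continuous G ->
  dist_of_fun (c *: F + G) phi = c * dist_of_fun F phi + dist_of_fun G phi.
Proof.
move=> cF cG; rewrite !dist_of_funE -RintegralZl//; last exact: paired_integrable.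
have ic : mu2.-integrable setT (EFin \o (fun z => c * paired F phi z)).
  have := integrableZl (measurableT) c (paired_integrable phi cF).
  by apply: eq_integrable.
rewrite -RintegralD//; last exact: paired_integrable.
by apply: eq_Rintegral => z _; rewrite /paired /restrict_plane !fctE /GRing.scale /=; ring.
Qed.

Lemma dist_of_fun_le a F phi M e : continuous F -> supp_in a phi ->
  (forall z, `|F z| <= M) -> (forall z, `|phi z| <= e) ->
  `|dist_of_fun F phi| <= M * e * fine (mu2 (square a)).
Proof.
move=> cF sp FM pe; rewrite dist_of_funE.
apply: (@supp_in_le _ a (paired F phi) (M * e)) => [||z].
- exact: continuous_paired (@testfun_continuous phi).
- exact: (@supp_in_paired a F phi sp).
- by rewrite /paired normrM; apply: ler_pM => //; exact: FM.
Qed.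

Lemma d12_lin F G (c : R) : continuous F -> continuous G ->
  d12 (c *: F + G) = c *: d12 F + d12 G.
Proof.
by move=> cF cG; apply/funext => phi; rewrite !fctE !d12E dist_of_fun_lin_fun.
Qed.

(** The supports stay in one square and [F] is bounded, so uniform convergence of
    the mixed derivatives of the test functions suffices. *)
Lemma d12_distribution F : continuous F -> is_distribution (d12 F).
Proof.
move=> cF; have [M FM] := continuous_bounded cF.
have slin : scalar (d12 F).
  by move=> c phi psi; rewrite !d12E test_partial12_is_linear dist_of_fun_lin_test.
split=> // u phi [[K cK uK] cu].
have [a Ka] := bounded_square cK; have [b pb] := testfun_supp phi.
pose c := Num.max a b.
have sq : square a `<=` square c /\ square b `<=` square c.
  split=> -[x y] [/=]; rewrite !in_itv/= => /andP[? ?] /andP[? ?].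
    have : a <= c by rewrite le_max lexx.
    by split; rewrite /= in_itv/=; apply/andP; split; lra.
  have : b <= c by rewrite le_max lexx orbT.
  by split; rewrite /= in_itv/=; apply/andP; split; lra.
pose v n := test_partial12 (u n) - test_partial12 phi.
have vE n : d12 F (u n) - d12 F phi = dist_of_fun F (v n).
  rewrite !d12E /v;
  have := dist_of_fun_lin_test (-1) (test_partial12 phi) (test_partial12 (u n)) cF.
  by rewrite scaleN1r mulN1r addrC [X in _ = X]addrC => ->.
have sv n : supp_in c (v n).
  have s1 : supp_in c (test_partial12 (u n)).
    by apply: support_in => z /support_partial/support_partial/uK/Ka; exact: sq.1.
  have s2 : supp_in c (test_partial12 phi).
    by apply: support_in => z /support_partial/support_partial/pb; exact: sq.2.
  move=> z Nz; rewrite -[LHS]/(test_partial12 (u n) z - test_partial12 phi z).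
  by rewrite s1// s2// subrr.
pose C := M * fine (mu2 (square c)).
apply/cvgrPdist_lt => e e0.
have C1 : 0 < `|C| + 1 by rewrite ltr_wpDl.
have : \forall n \near \oo, forall z, `|partials [:: true; false] (u n) z -
   partials [:: true; false] phi z| < e / (`|C| + 1).
  by apply: cu; rewrite divr_gt0.
apply: filterS => n hn; rewrite distrC vE.
have := @dist_of_fun_le c F (v n) M (e / (`|C| + 1)) cF (sv n) FM.
move=> /(_ (fun z => ltW (hn z))) /le_lt_trans; apply.
rewrite mulrAC -/C; apply: le_lt_trans (ler_wpM2r _ (ler_norm C)) _.
  by rewrite divr_ge0 ?ltW.
by rewrite mulrCA gtr_pMr// ltr_pdivrMr// mul1r ltrDl.
Qed.

Lemma smooth_slice b (p : R * R -> R) (z : R * R) : smooth p ->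
  is_derive (coordinate b z) 1 (slice b p z) (partial b p z).
Proof.
move=> sp; have [_ /(_ b z) d] := sp [::].
by apply: DeriveDef; [exact: d|rewrite /partial derive1E].
Qed.

Lemma is_derive_x (p : R * R -> R) (x y : R) : smooth p ->
  is_derive x 1 (fun t => p (t, y)) (partial false p (x, y)).
Proof. by move=> sp; exact: (@smooth_slice false p (x, y)). Qed.

Lemma is_derive_y (p : R * R -> R) (x y : R) : smooth p ->
  is_derive y 1 (fun t => p (x, t)) (partial true p (x, y)).
Proof. by move=> sp; exact: (@smooth_slice true p (x, y)). Qed.

Lemma MVT_increment (f f' : R -> R) (x h : R) : 0 < h ->
  (forall t : R, is_derive t 1 f (f' t)) ->
  exists2 c, x < c < x + h & f (x + h) - f x = f' c * h.
Proof.
move=> h0 df.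
have cf : {within `[x, (x + h)%R], continuous f}.
  apply: continuous_subspaceT => t; apply/differentiable_continuous/derivable1_diffP.
  by have [] := df t.
have xh : x < x + h by rewrite ltrDl.
have [c] := MVT xh (fun t _ => df t) cf.
rewrite in_itv/= => cx ->; exists c => //.
by rewrite addrAC subrr add0r.
Qed.

(** The mean value theorem is applied to the difference of two horizontal slices and
    then, at the point found, to the first partial derivative. *)
Lemma increment_partials (p : R * R -> R) (x y h : R) : smooth p -> 0 < h ->
  exists2 z : R * R, (x < z.1 < x + h) /\ (y < z.2 < y + h) &
    p (x + h, y + h) - p (x, y + h) - (p (x + h, y) - p (x, y)) =
    partial true (partial false p) z * h * h.
Proof.
move=> sp h0.
have [c cx] := @MVT_increment (fun t => p (t, y + h) - p (t, y))
  (fun t => partial false p (t, y + h) - partial false p (t, y)) x h h0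
  (fun t => is_deriveB (is_derive_x t (y + h) sp) (is_derive_x t y sp)).
have [e ey ->] := @MVT_increment (fun t => partial false p (c, t))
  (fun t => partial true (partial false p) (c, t)) y h h0
  (fun t => is_derive_y c t (smooth_partial false sp)).
by move=> h1; exists (c, e) => //; rewrite -h1; ring.
Qed.

(** Same increment as in [increment_partials], with the order of the variables
    exchanged in the two applications of the mean value theorem. *)
Lemma increment_partials_swap (p : R * R -> R) (x y h : R) : smooth p -> 0 < h ->
  exists2 z : R * R, (x < z.1 < x + h) /\ (y < z.2 < y + h) &
    p (x + h, y + h) - p (x, y + h) - (p (x + h, y) - p (x, y)) =
    partial false (partial true p) z * h * h.
Proof.
move=> sp h0.
have [e ey] := @MVT_increment (fun t => p (x + h, t) - p (x, t))
  (fun t => partial true p (x + h, t) - partial true p (x, t)) y h h0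
  (fun t => is_deriveB (is_derive_y (x + h) t sp) (is_derive_y x t sp)).
have [c cx ->] := @MVT_increment (fun t => partial true p (t, e))
  (fun t => partial false (partial true p) (t, e)) x h h0
  (fun t => is_derive_x t e (smooth_partial true sp)).
by move=> h1; exists (c, e) => //; rewrite -h1; ring.
Qed.

Lemma ball_of_interval (x h d u : R) : h <= d -> x < u < x + h -> ball x d u.
Proof.
by move=> hd /andP[? ?]; rewrite /ball /= ltr_distlC; apply/andP; split; lra.
Qed.

Lemma ball_of_box (x y h d : R) (u : R * R) : h <= d ->
  x < u.1 < x + h -> y < u.2 < y + h -> ball (x, y) d u.
Proof. by move=> hd h1 h2; split; exact: ball_of_interval hd _. Qed.

Lemma continuous_eq_of_boxes (q1 q2 : R * R -> R) (x y : R) :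
  continuous q1 -> continuous q2 ->
  (forall h : R, 0 < h -> exists z w, [/\ q1 z = q2 w,
    (x < z.1 < x + h) /\ (y < z.2 < y + h) & (x < w.1 < x + h) /\ (y < w.2 < y + h)]) ->
  q1 (x, y) = q2 (x, y).
Proof.
move=> c1 c2 near_eq; apply/eqP/negPn/negP => q12.
have e0 : 0 < `|q1 (x, y) - q2 (x, y)| / 2 by rewrite divr_gt0// normr_gt0 subr_eq0.
have /cvgrPdist_lt/(_ _ e0)/nbhs_ballP[d1 /= d10 h1] := c1 (x, y).
have /cvgrPdist_lt/(_ _ e0)/nbhs_ballP[d2 /= d20 h2] := c2 (x, y).
have [|z [w [zw [z1 z2] [w1 w2]]]] := near_eq (Num.min d1 d2).
  by rewrite lt_min d10 d20.
have hd1 : Num.min d1 d2 <= d1 by rewrite ge_min lexx.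
have hd2 : Num.min d1 d2 <= d2 by rewrite ge_min lexx orbT.
have k1 := h1 z (ball_of_box hd1 z1 z2).
have := h2 w (ball_of_box hd2 w1 w2); rewrite -zw distrC => k2.
have := ltrD k1 k2; rewrite -splitr ltNge => /negP; apply.
by rewrite -(subrKA (q1 z)) ler_normD.
Qed.

(** Both second derivatives take the value of the same difference quotient at points
    of arbitrarily small boxes at [(x, y)], and both are continuous. *)
Lemma partial_comm (p : R * R -> R) : smooth p ->
  partial true (partial false p) = partial false (partial true p).
Proof.
move=> sp; apply/funext => -[x y].
apply: (continuous_eq_of_boxes (sp [:: true; false]).1 (sp [:: false; true]).1).
move=> h h0; have [z zI zE] := increment_partials x y sp h0.
have [w wI wE] := increment_partials_swap x y sp h0.
exists z, w; split; [|exact: zI|exact: wI].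
by apply: (mulIf (lt0r_neq0 h0)); apply: (mulIf (lt0r_neq0 h0)); rewrite -[LHS]zE -[RHS]wE.
Qed.

Lemma integral_partial_x (p : R * R -> R) (y a : R) : 0 <= a -> smooth p -> supp_in a p ->
  \int[mu]_x partial false p (x, y) = 0.
Proof.
move=> a0 sp ap.
apply: (@integral_derivative0 _ a (fun x => p (x, y)) (fun x => partial false p (x, y))) => //.
- exact: supp_in_ysection.
- by move=> x; exact: is_derive_x.
- exact: continuous_ysection (sp [:: false]).1.
Qed.

Lemma integral_partial_y (p : R * R -> R) (x a : R) : 0 <= a -> smooth p -> supp_in a p ->
  \int[mu]_y partial true p (x, y) = 0.
Proof.
move=> a0 sp ap.
apply: (@integral_derivative0 _ a (fun y => p (x, y)) (fun y => partial true p (x, y))) => //.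
- exact: supp_in_xsection.
- by move=> y; exact: is_derive_y.
- exact: continuous_xsection (sp [:: true]).1.
Qed.

Lemma supp_in_le_radius (a b : R) (p : R * R -> R) : a <= b -> supp_in a p -> supp_in b p.
Proof.
move=> ab sp z Nz; apply: sp => -[]; rewrite /= !in_itv/= => /andP[? ?] /andP[? ?].
by apply: Nz; split; rewrite /= in_itv/=; apply/andP; split; lra.
Qed.

Lemma testfun_supp_ge0 phi : exists2 a, 0 <= a & supp_in a phi.
Proof.
have [a /support_in sa] := testfun_supp phi.
exists (Num.max 0 a); first by rewrite le_max lexx.
by apply: supp_in_le_radius sa; rewrite le_max lexx orbT.
Qed.

(** The inner integral is taken in the variable on which the function does not
    depend; it is the integral of a derivative with bounded support. *)
Lemma dist_of_fun_x (f : \bar R -> R) phi : continuous f ->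
  dist_of_fun (fun z => f z.1) (test_partial true phi) = 0.
Proof.
move=> cf; set F := fun z => _.
have cF : continuous F.
  by move=> z; apply: continuous_comp; [exact: cvg_fst|exact: cf].
have [a a0 sa] := testfun_supp_ge0 phi.
have [b /[dup] sb0 /support_in sb] := testfun_supp (test_partial true phi).
rewrite dist_of_funE (@supp_in_fubini12 _ b)//; last 2 first.
- exact: continuous_paired (@testfun_continuous _).
- exact: supp_in_paired.
under eq_Rintegral => x _.
  under eq_Rintegral => y _.
    rewrite /paired /restrict_plane /F /=; over.
  rewrite RintegralZl//; last first.
    apply: (@supp_in1_integrable _ b).
      exact: (@continuous_xsection _ _ _ (@testfun_continuous (test_partial true phi))).
    exact: (@supp_in_xsection _ _ _ _ sb).
  rewrite (integral_partial_y _ a0 (@testfun_smooth phi) sa) mulr0.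
  over.
by rewrite Rintegral_cst// mul0r.
Qed.

Lemma dist_of_fun_y (f : \bar R -> R) phi : continuous f ->
  dist_of_fun (fun z => f z.2) (test_partial false phi) = 0.
Proof.
move=> cf; set F := fun z => _.
have cF : continuous F.
  by move=> z; apply: continuous_comp; [exact: cvg_snd|exact: cf].
have [a a0 sa] := testfun_supp_ge0 phi.
have [b /[dup] sb0 /support_in sb] := testfun_supp (test_partial false phi).
rewrite dist_of_funE (@supp_in_fubini21 _ b)//; last 2 first.
- exact: continuous_paired (@testfun_continuous _).
- exact: supp_in_paired.
under eq_Rintegral => y _.
  under eq_Rintegral => x _.
    rewrite /paired /restrict_plane /F /=; over.
  rewrite RintegralZl//; last first.
    apply: (@supp_in1_integrable _ b).
      exact: (@continuous_ysection _ _ _ (@testfun_continuous (test_partial false phi))).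
    exact: (@supp_in_ysection _ _ _ _ sb).
  rewrite (integral_partial_x _ a0 (@testfun_smooth phi) sa) mulr0.
  over.
by rewrite Rintegral_cst// mul0r.
Qed.

Lemma d12_x (f : \bar R -> R) : continuous f -> d12 (fun z => f z.1) = 0.
Proof. by move=> cf; apply/funext => phi; rewrite d12E dist_of_fun_x. Qed.

Lemma d12_y (f : \bar R -> R) : continuous f -> d12 (fun z => f z.2) = 0.
Proof.
move=> cf; apply/funext => phi; rewrite d12E /test_partial12.
have -> : test_partial true (test_partial false phi) = test_partial false (test_partial true phi).
  by apply/val_inj; exact: partial_comm (@testfun_smooth phi).
by rewrite dist_of_fun_y.
Qed.

End DistributionOfFunction.

(** * Test functions built from a smooth step *)

Section SmoothFunctions.
Variable R : realType.
Notation mu := (@lebesgue_measure R).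
Implicit Types (x y k c : R) (m : nat).

(** The derivative of [flat m] combines [flat m.+1] and [flat m.+2], which makes
    all of these functions smooth; [flat 0] is the classical flat function
    exp(-1/x). *)
Definition flat m x : R := if 0 < x then x^-1 ^+ m * expR (- x^-1) else 0.

Lemma flat_ge0 m x : 0 <= flat m x.
Proof.
rewrite /flat; case: ifPn => // x0.
by rewrite mulr_ge0 ?expR_ge0// exprn_ge0// invr_ge0 ltW.
Qed.

(** With y = 1/x, this is y ^ (m + 1) <= (m + 1)! exp y. *)
Lemma flat_le m x : flat m x <= (m.+1)`!%:R * `|x|.
Proof.
rewrite /flat; case: ifPn => [x0|_]; last by rewrite mulr_ge0.
have y0 : 0 < x^-1 by rewrite invr_gt0.
have f0 : 0 < (m.+1)`!%:R :> R by rewrite ltr0n fact_gt0.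
have h : x^-1 ^+ m.+1 <= (m.+1)`!%:R * expR x^-1.
  rewrite -ler_pdivrMl// mulrC; apply: le_trans (expR_ge1Dxn m (ltW y0)).
  by rewrite lerDr.
rewrite gtr0_norm// expRN -ler_pdivrMr// -mulrA [_^-1 / x]mulrC mulrA -exprSr.
by rewrite ler_pdivrMr ?expR_gt0.
Qed.

Lemma flat_mul m x : flat m x = x * flat m.+1 x.
Proof.
rewrite /flat; case: ifPn => [x0|]; last by rewrite mulr0.
by rewrite mulrA exprS mulrA mulfV ?mul1r// gt_eqF.
Qed.

Lemma quadratic_is_derive0 (f : R -> R) (C : R) : (forall x, `|f x| <= C * `|x| ^+ 2) ->
  is_derive (0 : R) 1 f 0.
Proof.
move=> fC.
have f0 : f 0 = 0.
  by apply/eqP; rewrite -normr_le0; apply: le_trans (fC 0) _; rewrite normr0 expr0n mulr0.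
have C0 : 0 <= C by have := le_trans (normr_ge0 _) (fC 1); rewrite normr1 expr1n mulr1.
have lim : h^-1 *: (f (h *: 1 + 0) - f 0) @[h --> (0 : R)^'] --> (0 : R).
  apply/cvgr0Pnorm_lt => e e0; near=> h.
  have h0 : h != 0 by near: h; exact: nbhs_dnbhs_neq.
  rewrite f0 subr0 addr0 [h *: 1]mulr1 normrM normfV.
  rewrite mulrC ltr_pdivrMr ?normr_gt0//.
  apply: le_lt_trans (fC h) _.
  rewrite expr2 mulrA ltr_pM2r ?normr_gt0//.
  have : `|h| < e / (C + 1).
    near: h; apply: dnbhs0_lt; rewrite divr_gt0// ltr_wpDl//.
  rewrite ltr_pdivlMr ?ltr_wpDl// => hC.
  apply: le_lt_trans hC; rewrite mulrC ler_wpM2l//.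
  by rewrite lerDl.
apply: DeriveDef; first by apply/cvg_ex; exists 0.
exact: cvg_lim lim.
Unshelve. all: by end_near. Qed.

(** At 0 the derivative is 0, since [flat m x = x * flat m.+1 x] is quadratically
    small. *)
Lemma is_derive_flat m x :
  is_derive x 1 (flat m) (- m%:R * flat m.+1 x + flat m.+2 x).
Proof.
have [x0|x0|->] := ltgtP x 0.
- have -> : - m%:R * flat m.+1 x + flat m.+2 x = 0.
    by rewrite /flat ltNge (ltW x0) /= mulr0 addr0.
  apply: (near_eq_is_derive (f := cst 0)).
  near=> y; have y0 : y < 0 by near: y; exact: lt_nbhsl.
  by rewrite /flat ltNge (ltW y0).
- apply: (near_eq_is_derive (f := fun y => y^-1 ^+ m * expR (- y^-1))).
    near=> y; have y0 : 0 < y by near: y; exact: lt_nbhsr.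
    by rewrite /flat y0.
  rewrite /flat x0.
  have dV : is_derive x 1 (fun y : R => y^-1) (- x ^- 2).
    have := @is_deriveV R id x 1 1 (lt0r_neq0 x0) (is_derive_id x 1).
    by rewrite /GRing.scale /= mulr1.
  have dE : is_derive x 1 (fun y : R => expR (- y^-1)) (expR (- x^-1) * x ^- 2).
    have dN : is_derive x 1 (fun y : R => - y^-1) (x ^- 2).
      by have := is_deriveN dV; rewrite opprK.
    exact: (@is_derive1_comp R expR (fun y => - y^-1) x _ _ (is_derive_expR (- x^-1)) dN).
  have dX : is_derive x 1 (fun y : R => y^-1 ^+ m) (m%:R * x^-1 ^+ m.-1 * - x ^- 2).
    have := is_deriveX m dV.
    by rewrite fctE.
  have := is_deriveM dX dE.
  move=> h; apply: is_derive_eq.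
  rewrite /GRing.scale /= -!exprVn.
  by case: (m) => [|n]; rewrite ?expr0 /= !exprS; ring.
- have -> : - m%:R * flat m.+1 0 + flat m.+2 0 = 0 :> R.
    by rewrite /flat ltxx mulr0 addr0.
  apply: (@quadratic_is_derive0 _ (m.+2)`!%:R) => t.
  rewrite ger0_norm ?flat_ge0// flat_mul.
  apply: le_trans (ler_norm _) _; rewrite normrM (ger0_norm (flat_ge0 _ _)).
  by rewrite expr2 mulrCA ler_wpM2l// flat_le.
Unshelve. all: by end_near. Qed.
End SmoothFunctions.

Section Bumps.
Variable R : realType.
Notation mu := (@lebesgue_measure R).
Implicit Types (x y k c : R) (m : nat) (f g : R -> R).

Definition rho x : R := flat 0 x * flat 0 (1 - x).

Lemma rho_ge0 x : 0 <= rho x.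
Proof. by rewrite mulr_ge0// flat_ge0. Qed.

Lemma rho_out x : ~~ (0 < x < 1) -> rho x = 0.
Proof.
rewrite /rho /flat negb_and; case: ifPn => //= x0; last by rewrite mul0r.
by move=> x1; rewrite subr_gt0 (negbTE x1) mulr0.
Qed.

Lemma rho_gt0 x : 0 < x < 1 -> 0 < rho x.
Proof.
by move=> /andP[x0 x1]; rewrite /rho /flat subr_gt0 x0 x1 !expr0 !mul1r mulr_gt0 ?expR_gt0.
Qed.

Lemma is_derive_affine f f' k c x : (forall y : R, is_derive y 1 f (f' y)) ->
  is_derive x 1 (fun x => f (k * x + c)) (k * f' (k * x + c)).
Proof.
move=> df.
have dA : is_derive x 1 (fun x : R => k * x + c) k.
  have dk : is_derive x 1 (fun x : R => k * x) k.
    by have := is_deriveZ k (is_derive_id x 1); rewrite /GRing.scale /= mulr1.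
  by have := is_deriveD dk (is_derive_cst c x 1); rewrite addr0.
rewrite mulrC.
exact: (@is_derive1_comp R f (fun x => k * x + c) x _ _ (df _) dA).
Qed.

Lemma is_derive_continuous f f' : (forall x : R, is_derive x 1 f (f' x)) -> continuous f.
Proof.
move=> df x; apply/differentiable_continuous/derivable1_diffP.
by have [] := df x.
Qed.

Lemma continuous_flat m : continuous (@flat R m).
Proof. exact: is_derive_continuous (is_derive_flat m). Qed.

Lemma continuous_rho : continuous rho.
Proof.
move=> x; apply: continuousM; first exact: continuous_flat.
apply: continuous_comp; last exact: continuous_flat.
by apply: continuousB; [exact: cst_continuous|exact: cvg_id].
Qed.

(** The lower bound -1 leaves every nonnegative point strictly inside the domain of
    integration, where the fundamental theorem of calculus applies. *)
Definition step x : R := \int[mu]_(t in `[-1, x]) rho t.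

Lemma step_le0 x : x <= 0 -> step x = 0.
Proof.
move=> x0; rewrite /step (@eq_Rintegral _ _ _ mu _ (cst 0)) ?Rintegral_cst ?mul0r//.
move=> t /set_mem; rewrite /= in_itv/= => /andP[_ tx].
by rewrite rho_out// negb_and -leNgt (le_trans tx x0).
Qed.

Lemma is_derive_step x : is_derive x 1 step (rho x).
Proof.
have [x0|x0] := ltP x 0.
  rewrite rho_out ?ltNge ?(ltW x0)//.
  apply: (near_eq_is_derive (f := cst 0)).
  near=> y; have y0 : y < 0 by near: y; exact: lt_nbhsl.
  by rewrite step_le0// ltW.
have irho : mu.-integrable `[-1, x + 1] (EFin \o rho).
  apply: continuous_compact_integrable; first exact: segment_compact.
  exact/continuous_subspaceT/continuous_rho.
have [] := @continuous_FTC1_closed R rho (-1) x (x + 1) _ irho _ (@continuous_rho x).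
- by rewrite ltrDl.
- by apply: lt_le_trans x0; rewrite oppr_lt0.
move=> d1 d2; apply: DeriveDef; first exact: d1.
by rewrite -d2 derive1E.
Unshelve. all: by end_near. Qed.

Definition height := step 1.

(** By the mean value theorem, the height is a value of [rho] inside [[0, 1]]. *)
Lemma height_gt0 : 0 < height.
Proof.
have [c] := MVT_increment 0 ltr01 is_derive_step.
rewrite add0r => c01; rewrite (step_le0 (lexx 0)) subr0 mulr1 /height => ->.
exact: rho_gt0.
Qed.

Lemma step_ge1 x : 1 <= x -> step x = height.
Proof.
rewrite le_eqVlt => /predU1P[<-//|x1].
have := integral_derivative x1 is_derive_step continuous_rho.
rewrite (@eq_Rintegral _ _ _ mu _ (cst 0)) ?Rintegral_cst ?mul0r//.
  by move=> /eqP; rewrite eq_sym subr_eq0 => /eqP.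
move=> t /set_mem; rewrite /= in_itv/= => /andP[t1 _].
by rewrite rho_out// negb_and -!leNgt t1 orbT.
Qed.

(** A class of functions that is stable under differentiation, hence made of smooth
    functions.  Closure under products is needed because the derivative [rho] of
    a step is a product of two flat functions. *)
Inductive elementary : (R -> R) -> Prop :=
| Elem_flat m k c : elementary (fun x => flat m (k * x + c))
| Elem_step k c : elementary (fun x => step (k * x + c))
| Elem_lin a f g : elementary f -> elementary g -> elementary (fun x => a * f x + g x)
| Elem_mul f g : elementary f -> elementary g -> elementary (fun x => f x * g x).

Lemma elementary0 : elementary (fun=> 0).
Proof.
have -> : (fun=> 0) = (fun x : R => flat 0 (0 * x + 0)).
  by apply/funext => x; rewrite mul0r addr0 /flat ltxx.
exact: Elem_flat.
Qed.

Lemma elementary_scale a f : elementary f -> elementary (fun x => a * f x).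
Proof.
move=> ef; have := Elem_lin a ef elementary0.
by under eq_fun do rewrite addr0.
Qed.

Lemma elementary_add f g : elementary f -> elementary g -> elementary (fun x => f x + g x).
Proof.
by move=> ef eg; have := Elem_lin 1 ef eg; under eq_fun do rewrite mul1r.
Qed.

Lemma elementary_derive f : elementary f ->
  exists2 f', elementary f' & forall x : R, is_derive x 1 f (f' x).
Proof.
elim=> [m k c|k c|a {}f g ef [f' ef' df] eg [g' eg' dg]|{}f g ef [f' ef' df] eg [g' eg' dg]].
- exists (fun x => k * (- m%:R * flat m.+1 (k * x + c) + flat m.+2 (k * x + c))).
    apply: elementary_scale; apply: Elem_lin; exact: Elem_flat.
  move=> x; apply: (@is_derive_affine (flat m) (fun y => - m%:R * flat m.+1 y + flat m.+2 y)).
  exact: is_derive_flat.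
- exists (fun x => k * rho (k * x + c)); last first.
    by move=> x; apply: is_derive_affine; exact: is_derive_step.
  apply: elementary_scale; apply: Elem_mul; first exact: Elem_flat.
  have -> : (fun x => flat 0 (1 - (k * x + c))) = (fun x => flat 0 (- k * x + (1 - c))).
    by apply/funext => x; congr flat; ring.
  exact: Elem_flat.
- exists (fun x => a * f' x + g' x); first exact: Elem_lin.
  by move=> x; exact: (is_deriveD (is_deriveZ a (df x)) (dg x)).
- exists (fun x => f x * g' x + g x * f' x).
    by apply: elementary_add; apply: Elem_mul.
  by move=> x; exact: (is_deriveM (df x) (dg x)).
Qed.

Definition tensor f g (z : R * R) : R := f z.1 * g z.2.

Lemma continuous_tensor f g : continuous f -> continuous g -> continuous (tensor f g).
Proof.
move=> cf cg z; apply: cvgM.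
  by apply: continuous_comp; [exact: cvg_fst|exact: cf].
by apply: continuous_comp; [exact: cvg_snd|exact: cg].
Qed.

Lemma partial_tensor_x f f' g : (forall x : R, is_derive x 1 f (f' x)) ->
  partial false (tensor f g) = tensor f' g.
Proof.
move=> df; apply/funext => -[x y]; rewrite /partial /tensor /= derive1E.
have := is_deriveZ (g y) (df x).
have -> : (g y \*: f) = (fun t => f t * g y).
  by apply/funext => t; exact: mulrC.
by move=> d; rewrite derive_val /GRing.scale /= mulrC.
Qed.

Lemma partial_tensor_y f g g' : (forall x : R, is_derive x 1 g (g' x)) ->
  partial true (tensor f g) = tensor f g'.
Proof.
move=> dg; apply/funext => -[x y]; rewrite /partial /tensor /= derive1E.
have := is_deriveZ (f x) (dg y).
by move=> d; rewrite derive_val.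
Qed.

Lemma elementary_continuous f : elementary f -> continuous f.
Proof. by move=> /elementary_derive[f' _]; exact: is_derive_continuous. Qed.

Lemma elementary_partials f g s : elementary f -> elementary g ->
  exists f' g', [/\ elementary f', elementary g' & partials s (tensor f g) = tensor f' g'].
Proof.
move=> ef eg; elim: s => [|b s [f' [g' [ef' eg' /= ->]]]]; first by exists f, g.
case: b.
  have [g'' eg'' dg] := elementary_derive eg'.
  by exists f', g''; rewrite (partial_tensor_y f' dg).
have [f'' ef'' df] := elementary_derive ef'.
by exists f'', g'; rewrite (partial_tensor_x g' df).
Qed.

Lemma elementary_smooth f g : elementary f -> elementary g -> smooth (tensor f g).
Proof.
move=> ef eg s; have [f' [g' [ef' eg' ->]]] := elementary_partials s ef eg.
split; first exact: continuous_tensor (elementary_continuous ef') (elementary_continuous eg').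
have [f'' _ df] := elementary_derive ef'; have [g'' _ dg] := elementary_derive eg'.
move=> [] [x y] /=.
  by have [] := is_deriveZ (f' x) (dg y).
rewrite [X in derivable X](_ : _ = g' y \*: f'); last first.
  by apply/funext => t; exact: mulrC.
by have [] := is_deriveZ (g' y) (df x).
Qed.

Lemma supp_in_tensor a f g : supp_in1 a f -> supp_in1 a g -> supp_in a (tensor f g).
Proof.
move=> sf sg [x y] Nz; rewrite /tensor /=.
have [ax|/sf ->] := pselect (segment a x); last by rewrite mul0r.
have [ay|/sg ->] := pselect (segment a y); last by rewrite mulr0.
by exfalso; apply: Nz.
Qed.

Lemma compact_square (a : R) : compact (square a).
Proof. by apply: compact_setX; exact: segment_compact. Qed.

Lemma supp_in_compact a (p : R * R -> R) : supp_in a p -> compact (Defs.support p).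
Proof.
move=> sp; have cs : compact (square a) by exact: compact_square.
apply: (subclosed_compact _ cs); first exact: closed_closure.
have cl : closed (square a).
  by apply: compact_closed; [exact: norm_hausdorff|exact: compact_square].
have -> : square a = closure (square a) by apply/closure_id.
apply: closureS => z /= pz; apply: contrapT => Nz.
by move: pz; rewrite sp// eqxx.
Qed.

Lemma tensor_testfun a f g : elementary f -> elementary g ->
  supp_in1 a f -> supp_in1 a g -> tensor f g \in @testfun_pred R.
Proof.
move=> ef eg sf sg; apply/testfun_predP; split; first exact: elementary_smooth.
exact: supp_in_compact (supp_in_tensor sf sg).
Qed.

End Bumps.

(** * Uniqueness of the primitive *)

Section Uniqueness.
Variable R : realType.
Notation mu := (@lebesgue_measure R).
Notation mu2 := (lebesgue_measure \x lebesgue_measure)%E.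
Implicit Types (x y k c : R) (F : \bar R * \bar R -> R).

(** The derivative of a step squeezed by [k] and shifted by [c]; its integral is
    [height R] for all [k > 0] and [c]. *)
Definition bump k c x : R := k * rho (k * x + c).

Lemma is_derive_bump k c x : is_derive x 1 (fun x => step (k * x + c)) (bump k c x).
Proof. by apply: is_derive_affine; exact: is_derive_step. Qed.

Lemma elementary_bump k c : elementary (bump k c).
Proof.
have [f' ef' df] := elementary_derive (Elem_step k c).
suff -> : bump k c = f' by [].
by apply/funext => x; rewrite -(@derive_val _ _ _ _ _ _ _ (df x))
  (@derive_val _ _ _ _ _ _ _ (is_derive_bump k c x)).
Qed.

Lemma continuous_bump k c : continuous (bump k c).
Proof. exact: elementary_continuous (elementary_bump k c). Qed.

Lemma bump_ge0 k c x : 0 < k -> 0 <= bump k c x.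
Proof. by move=> k0; rewrite mulr_ge0 ?rho_ge0// ltW. Qed.

Lemma bump_out k c x : ~~ (0 < k * x + c < 1) -> bump k c x = 0.
Proof. by move=> h; rewrite /bump rho_out// mulr0. Qed.

(** Outside [[- radius k c, radius k c]] the values of [k * x + c] avoid the interval
    from 0 to 1, on which [rho] lives. *)
Definition radius k c := (`|c| + 1) / k.

Lemma radius_gt0 k c : 0 < k -> 0 < radius k c.
Proof. by move=> k0; rewrite divr_gt0// ltr_wpDl. Qed.

Lemma radius_right k c x : 0 < k -> radius k c <= x -> 1 <= k * x + c.
Proof.
move=> k0; rewrite /radius ler_pdivrMr// mulrC => h.
have : - c <= `|c| by rewrite -normrN ler_norm.
lra.
Qed.

Lemma radius_left k c x : 0 < k -> x <= - radius k c -> k * x + c <= 0.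
Proof.
move=> k0; rewrite lerNr /radius ler_pdivrMr// mulrC mulrN => h.
have := ler_norm c.
lra.
Qed.

Lemma not_segment (a x : R) : ~ segment a x -> x <= - a \/ a <= x.
Proof.
move=> /negP; rewrite -in_setE => /negP; rewrite inE /segment /= in_itv/= => /negP.
by rewrite negb_and -!ltNge => /orP[/ltW|/ltW]; [left|right].
Qed.

Lemma supp_in1_bump k c (a : R) : 0 < k -> radius k c <= a -> supp_in1 a (bump k c).
Proof.
move=> k0 ra x /not_segment[xa|ax]; apply: bump_out; rewrite negb_and -!leNgt.
  by rewrite radius_left// (le_trans xa)// lerN2.
by rewrite (radius_right k0 (le_trans ra ax)) orbT.
Qed.

Lemma bump_integral k c : 0 < k -> \int[mu]_x bump k c x = height R.
Proof.
move=> k0; have r0 := radius_gt0 c k0.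
have cb := @continuous_bump k c.
rewrite (supp_in1_Rintegral cb (supp_in1_bump k0 (lexx _))).
rewrite (integral_derivative _ (is_derive_bump k c) cb); last by rewrite gt0_cp.
rewrite step_ge1 ?radius_right// step_le0 ?subr0// radius_left//.
Qed.

(** This holds at infinite points too, whose neighbourhoods contain real segments;
    so the value of [F] at such points can be tested directly. *)
Lemma nbhs_bump (a : \bar R) (A : set (\bar R)) : nbhs a A ->
  exists k c, 0 < k /\ forall x, 0 < k * x + c < 1 -> A x%:E.
Proof.
move=> /nbhs_ereal_segment[l [r [/andP[la ar] hl hr lrA]]].
have lr : (l < r)%E.
  case: hl => [aE|la']; last exact: lt_le_trans la' ar.
  by case: hr => [aE'|ar']; [move: aE'; rewrite aE|exact: le_lt_trans la ar'].
have [u /andP[lu ur]] := ereal_between lr.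
have [v /andP[uv vr]] := ereal_between ur.
rewrite lte_fin in uv; have uv0 : 0 < v - u by rewrite subr_gt0.
exists (v - u)^-1, (- u / (v - u)); split; first by rewrite invr_gt0.
move=> x; rewrite [_^-1 * x]mulrC -mulrDl.
rewrite pmulr_lgt0 ?invr_gt0// ltr_pdivrMr// mul1r => /andP[h1 h2].
apply: lrA; rewrite (le_trans (ltW lu)) ?lee_fin; last by lra.
by rewrite (le_trans _ (ltW vr))// lee_fin; lra.
Qed.

(** A product of bumps concentrated where [F] is close to [v] behaves like
    [height R ^+ 2] times a Dirac mass. *)
Lemma bump_tensor_close F k1 c1 k2 c2 (v e : R) : continuous F -> 0 < k1 -> 0 < k2 ->
  (forall x y, 0 < k1 * x + c1 < 1 -> 0 < k2 * y + c2 < 1 -> `|F (x%:E, y%:E) - v| <= e) ->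
  `|\int[mu2]_z paired F (tensor (bump k1 c1) (bump k2 c2)) z - v * height R ^+ 2|
    <= e * height R ^+ 2.
Proof.
move=> cF k10 k20 Fv.
pose T := tensor (bump k1 c1) (bump k2 c2).
have cT : continuous T by apply: continuous_tensor; exact: continuous_bump.
pose a := Num.max (radius k1 c1) (radius k2 c2).
have s1 : supp_in1 a (bump k1 c1) by apply: supp_in1_bump => //; rewrite le_max lexx.
have s2 : supp_in1 a (bump k2 c2) by apply: supp_in1_bump => //; rewrite le_max lexx orbT.
have sT : supp_in a T by exact: supp_in_tensor.
have T0 z : 0 <= T z by rewrite mulr_ge0// bump_ge0.
have iT := supp_in_integrable cT sT.
have iP := supp_in_integrable (continuous_paired cF cT) (@supp_in_paired R a F T sT).
have intT : \int[mu2]_z T z = height R ^+ 2.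
  rewrite (supp_in_fubini12 cT sT).
  have i1 := supp_in1_integrable (@continuous_bump k1 c1) s1.
  have i2 := supp_in1_integrable (@continuous_bump k2 c2) s2.
  have E x : \int[mu]_y T (x, y) = bump k1 c1 x * height R.
    by rewrite -(bump_integral c2 k20); exact: (RintegralZl (bump k1 c1 x) measurableT i2).
  under eq_Rintegral do rewrite E.
  by rewrite (RintegralZr _ measurableT i1) bump_integral.
have ivT : mu2.-integrable setT (EFin \o (fun z => v * T z)).
  by have := integrableZl measurableT v iT; exact: eq_integrable.
have ieT : mu2.-integrable setT (EFin \o (fun z => e * T z)).
  by have := integrableZl measurableT e iT; exact: eq_integrable.
rewrite -intT -!RintegralZl// -RintegralB//.
have iB : mu2.-integrable setT (EFin \o (fun z => paired F T z - v * T z)).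
  have := integrableB measurableT iP ivT; apply: eq_integrable => //.
apply: le_trans (le_normr_Rintegral measurableT iB) _.
apply: le_Rintegral => // [|[x y] _].
  by have := integrable_abse iB; apply: eq_integrable.
rewrite /paired -mulrBl normrM (ger0_norm (T0 _)).
have [h1|/bump_out h1] := boolP (0 < k1 * x + c1 < 1); last first.
  by rewrite /T /tensor /= h1 mul0r !mulr0.
have [h2|/bump_out h2] := boolP (0 < k2 * y + c2 < 1); last first.
  by rewrite /T /tensor /= h2 !mulr0.
by apply: ler_wpM2r; [exact: T0|exact: Fv].
Qed.

Lemma supp_in1_step_diff k c k' c' (a : R) : 0 < k -> 0 < k' ->
  radius k c <= a -> radius k' c' <= a ->
  supp_in1 a (fun x => -1 * step (k' * x + c') + step (k * x + c)).
Proof.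
move=> k0 k0' ra ra' x /not_segment[xa|ax].
  by rewrite !step_le0 ?mulr0 ?addr0// radius_left// (le_trans xa)// lerN2.
by rewrite !step_ge1 ?mulN1r ?addNr// radius_right// (le_trans _ ax).
Qed.

Definition four_point F (a b : \bar R) : R :=
  F (-oo%E, -oo%E) + F (a, b) - F (-oo%E, b) - F (a, -oo%E).

(** The test function is a product of two differences of steps, so that its mixed
    derivative is a signed sum of four products of bumps, one near each of the
    four points.  If the four point expression were nonzero, a fifth of its modulus
    would be a precision that the four errors together cannot exceed. *)
Lemma d12_kernel F : continuous F -> d12 F = 0 -> forall a b, four_point F a b = 0.
Proof.
move=> cF dF0 a b; apply/eqP/negPn/negP => D0.
pose D := four_point F a b; pose e := `|D| / 5.
have e0 : 0 < e by rewrite divr_gt0// normr_gt0.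
have near_pt (p q : \bar R) : exists A B, [/\ nbhs p A, nbhs q B &
    forall x y : R, A x%:E -> B y%:E -> `|F (x%:E, y%:E) - F (p, q)| <= e].
  have /cvgrPdist_lt/(_ _ e0)[[A B] /= [nA nB] AB] := cF (p, q).
  exists A, B; split=> // x y Ax By; rewrite distrC ltW//.
  exact: (AB (x%:E, y%:E)).
have [A00 [B00 [nA00 nB00 h00]]] := near_pt -oo%E -oo%E.
have [A01 [B01 [nA01 nB01 h01]]] := near_pt -oo%E b.
have [A10 [B10 [nA10 nB10 h10]]] := near_pt a -oo%E.
have [A11 [B11 [nA11 nB11 h11]]] := near_pt a b.
(* bumps of one variable serve two of the four points, hence the intersections *)
have [k0 [c0 [k00 hA0]]] := nbhs_bump (filterI nA00 nA01).
have [k1 [c1 [k10 hA1]]] := nbhs_bump (filterI nA10 nA11).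
have [m0 [d0 [m00 hB0]]] := nbhs_bump (filterI nB00 nB10).
have [m1 [d1 [m10 hB1]]] := nbhs_bump (filterI nB01 nB11).
pose r := Num.max (Num.max (radius k0 c0) (radius k1 c1)) (Num.max (radius m0 d0) (radius m1 d1)).
have [r1 r2 r3 r4] : [/\ radius k0 c0 <= r, radius k1 c1 <= r,
    radius m0 d0 <= r & radius m1 d1 <= r].
  by rewrite /r !le_max !lexx ?orbT.
pose phi k c m d (kr : 0 < k) (mr : 0 < m)
  (hk : radius k c <= r) (hm : radius m d <= r) : testfun R :=
  TestFun (tensor_testfun (elementary_bump k c) (elementary_bump m d)
    (supp_in1_bump kr hk) (supp_in1_bump mr hm)).
pose Phi : testfun R := TestFun (tensor_testfun
  (Elem_lin (-1) (Elem_step k1 c1) (Elem_step k0 c0))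
  (Elem_lin (-1) (Elem_step m1 d1) (Elem_step m0 d0))
  (supp_in1_step_diff k00 k10 r1 r2) (supp_in1_step_diff m00 m10 r3 r4)).
pose p00 := phi _ _ _ _ k00 m00 r1 r3; pose p01 := phi _ _ _ _ k00 m10 r1 r4.
pose p10 := phi _ _ _ _ k10 m00 r2 r3; pose p11 := phi _ _ _ _ k10 m10 r2 r4.
have PhiE : test_partial12 Phi = -1 *: p01 + (-1 *: p10 + (1 *: p11 + p00)).
  apply/val_inj => /=.
  have dstep k c k' c' (x : R) : is_derive x 1
      (fun x => -1 * step (k' * x + c') + step (k * x + c)) (-1 * bump k' c' x + bump k c x).
    exact: (is_deriveD (is_deriveZ (-1) (is_derive_bump k' c' x)) (is_derive_bump k c x)).
  rewrite (partial_tensor_x _ (dstep k0 c0 k1 c1)) (partial_tensor_y _ (dstep m0 d0 m1 d1)).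
  by apply/funext => -[x y]; rewrite /tensor /= !fctE /GRing.scale /=; ring.
have : d12 F Phi = 0 by rewrite dF0.
rewrite d12E PhiE !dist_of_fun_lin_test// => E.
pose H := height R ^+ 2.
have H0 : 0 < H by rewrite exprn_gt0// height_gt0.
have b00 : `|dist_of_fun F p00 - F (-oo%E, -oo%E) * H| <= e * H.
  apply: bump_tensor_close => // x y /hA0[hx _] /hB0[hy _]; exact: h00.
have b01 : `|dist_of_fun F p01 - F (-oo%E, b) * H| <= e * H.
  apply: bump_tensor_close => // x y /hA0[_ hx] /hB1[hy _]; exact: h01.
have b10 : `|dist_of_fun F p10 - F (a, -oo%E) * H| <= e * H.
  apply: bump_tensor_close => // x y /hA1[hx _] /hB0[_ hy]; exact: h10.
have b11 : `|dist_of_fun F p11 - F (a, b) * H| <= e * H.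
  apply: bump_tensor_close => // x y /hA1[_ hx] /hB1[_ hy]; exact: h11.
have : `|D * H| <= 4 * (e * H).
  move: b00 b01 b10 b11 E; rewrite /D /four_point; clear.
  move: (dist_of_fun F p00) (dist_of_fun F p01) (dist_of_fun F p10) (dist_of_fun F p11).
  move: (F _) (F _) (F _) (F _) => u1 u2 u3 u4 J1 J2 J3 J4.
  rewrite !ler_norml => /andP[? ?] /andP[? ?] /andP[? ?] /andP[? ?] E.
  apply/andP; split; lra.
rewrite normrM (gtr0_norm H0) mulrA ler_pM2r// /e mulrCA ler_pMr ?normr_gt0//.
by rewrite ler_pdivlMr// mul1r ler_nat.
Qed.

End Uniqueness.

(** * The Banach lattice of mixed derivatives *)

Section Isomorphism.
Variable R : realType.
Implicit Types (F G : \bar R * \bar R -> R) (f g : testfun R -> R).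

Lemma d12B F G : continuous F -> continuous G -> d12 (F - G) = d12 F - d12 G.
Proof. by move=> cF cG; rewrite addrC -scaleN1r d12_lin// scaleN1r addrC. Qed.

Lemma d12_inj F G : Bc_set F -> Bc_set G -> d12 F = d12 G -> F = G.
Proof.
move=> BF BG FG; have [cFG FG0] := BcB BF BG.
have := d12_kernel cFG; rewrite (d12B BF.1 BG.1) FG subrr => /(_ erefl) k.
apply/funext => -[a b]; apply/eqP; rewrite -subr_eq0; apply/eqP.
have := k a b; rewrite /four_point (FG0 _).1 (FG0 b).1 (FG0 a).2.
by rewrite add0r !subr0.
Qed.

Lemma d12_bij : set_bij (elt (Bc R)) (elt (Ac R)) (@d12 R).
Proof.
split=> [F BF|F G /set_mem BF /set_mem BG|f [_ [F BF ->]]].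
- by split; [exact/d12_distribution/BF.1|exists F].
- exact: d12_inj.
- by exists F.
Qed.

Lemma primitive_d12 F : Bc_set F -> primitive (d12 F) = F.
Proof.
move=> BF; apply: xget_unique; first by split.
by move=> G [BG /d12_inj]; exact.
Qed.

Lemma Ac_le_d12 F G : Bc_set F -> Bc_set G -> Bc_le F G <-> Ac_le (d12 F) (d12 G).
Proof.
move=> BF BG; split=> [FG|[F' [G' [[BF' F'E] [BG' G'E] FG]]]]; first by exists F, G.
by rewrite -(d12_inj BF' BF F'E) -(d12_inj BG' BG G'E).
Qed.

Lemma alexiewicz_d12 F : Bc_set F -> alexiewicz (d12 F) = supnorm F.
Proof. by move=> BF; rewrite /alexiewicz primitive_d12. Qed.

Lemma d12_Bc_lin (a : R) F G : elt (Bc R) F -> elt (Bc R) G ->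
  d12 (a *: F + G) = a *: d12 F + d12 G.
Proof. by move=> BF BG; exact: d12_lin BF.1 BG.1. Qed.

(** The element of B_c with the same mixed derivative as [F]: the values on the two
    lower edges, functions of one variable, are subtracted. *)
Definition edge_normal F : \bar R * \bar R -> R := fun z => four_point F z.1 z.2.

Let lower_edge F (x : \bar R) : R := F (x, -oo%E) - F (-oo%E, -oo%E).
Let left_edge F (y : \bar R) : R := F (-oo%E, y).

Lemma edge_normalE F : edge_normal F =
  F - (fun z => lower_edge F z.1) - (fun z => left_edge F z.2).
Proof.
apply/funext => -[x y]; rewrite /edge_normal /four_point /lower_edge /left_edge !fctE /=; ring.
Qed.

Lemma continuous_lower_edge F : continuous F -> continuous (lower_edge F).
Proof.
move=> cF x; apply: continuousB; last exact: cst_continuous.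
by apply: continuous_comp; [exact: continuous_pairr|exact: cF].
Qed.

Lemma continuous_left_edge F : continuous F -> continuous (left_edge F).
Proof.
by move=> cF x; apply: continuous_comp; [exact: continuous_pairl|exact: cF].
Qed.

Lemma continuous_fst_snd (h : \bar R -> R) : continuous h ->
  continuous (fun z : \bar R * \bar R => h z.1) /\ continuous (fun z : \bar R * \bar R => h z.2).
Proof.
move=> ch; split=> z; apply: continuous_comp; [exact: cvg_fst|exact: ch|exact: cvg_snd|exact: ch].
Qed.

Lemma Bc_edge_normal F : continuous F -> Bc_set (edge_normal F).
Proof.
move=> cF; split=> [z|s]; last by rewrite /edge_normal /four_point /=; split; ring.
rewrite edge_normalE; apply: continuousB; first apply: continuousB.
- exact: cF.
- exact: (continuous_fst_snd (continuous_lower_edge cF)).1.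
- exact: (continuous_fst_snd (continuous_left_edge cF)).2.
Qed.

Lemma d12_edge_normal F : continuous F -> d12 (edge_normal F) = d12 F.
Proof.
move=> cF; have c1 := continuous_lower_edge cF; have c2 := continuous_left_edge cF.
have [c1' _] := continuous_fst_snd c1; have [_ c2'] := continuous_fst_snd c2.
rewrite edge_normalE d12B//; last by move=> z; apply: continuousB; [exact: cF|exact: c1'].
by rewrite d12B// d12_x// d12_y// !subr0.
Qed.

End Isomorphism.

Theorem theorem11p1 (R : realType) :
  (* (a) *)
  is_banach_lattice (Bc R) /\
  (* (b) *)
  (is_banach_lattice (Ac R) /\
   is_banach_lattice_iso (Bc R) (Ac R) (@d12 R)) /\
  (* (c) *)
  (~ (exists e, is_order_unit (Bc R) e) /\
   ~ (exists e, is_order_unit (Ac R) e)) /\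
  (* (d) *)
  (forall F F1 F2 : \bar R * \bar R -> R,
     elt (Bc R) F -> elt (Bc R) F1 -> elt (Bc R) F2 ->
     [/\ d12 (join (Bc R) F1 F2) = join (Ac R) (d12 F1) (d12 F2),
         d12 (meet (Bc R) F1 F2) = meet (Ac R) (d12 F1) (d12 F2),
         labs (Ac R) (d12 F) = d12 (labs (Bc R) F),
         d12 (lpos (Bc R) F) = lpos (Ac R) (d12 F) &
         d12 (lneg (Bc R) F) = lneg (Ac R) (d12 F)]) /\
  (* (e) *)
  (forall (f : testfun R -> R) (F : \bar R * \bar R -> R),
     elt (Ac R) f -> is_primitive F f ->
     [/\ elt (Ac R) (labs (Ac R) f) /\
         is_primitive (labs (Bc R) F) (labs (Ac R) f),
         forall x y : \bar R, Ac_int (labs (Ac R) f) x y = `|Ac_int f x y|,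
         onorm (Ac R) (labs (Ac R) f) = onorm (Ac R) f,
         onorm (Ac R) (lpos (Ac R) f) <= onorm (Ac R) f &
         onorm (Ac R) (lneg (Ac R) f) <= onorm (Ac R) f]) /\
  (* (f) *)
  (forall (f : testfun R -> R) (F : \bar R * \bar R -> R),
     elt (Ac R) f -> is_primitive F f ->
     [/\ elt (Ac R) (lpos (Ac R) f) /\
         is_primitive (lpos (Bc R) F) (lpos (Ac R) f),
         elt (Ac R) (lneg (Ac R) f) /\
         is_primitive (lneg (Bc R) F) (lneg (Ac R) f),
         f = lpos (Ac R) f - lneg (Ac R) f &
         forall g : \bar R * \bar R -> R, HKBV R g ->
           [/\ prod_integrable f g,
               prod_integrable (lpos (Ac R) f) g,
               prod_integrable (lneg (Ac R) f) g &
               int_prod f g =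
               int_prod (lpos (Ac R) f) g - int_prod (lneg (Ac R) f) g]]) /\
  (* (g) *)
  (forall f1 f2 f3 : testfun R -> R,
     elt (Ac R) f1 -> elt (Ac R) f2 -> elt (Ac R) f3 ->
     meet (Ac R) f1 (join (Ac R) f2 f3) =
     join (Ac R) (meet (Ac R) f1 f2) (meet (Ac R) f1 f3) /\
     join (Ac R) f1 (meet (Ac R) f2 f3) =
     meet (Ac R) (join (Ac R) f1 f2) (join (Ac R) f1 f3)) /\
  (* (h) *)
  (forall f1 f2 : testfun R -> R, elt (Ac R) f1 -> elt (Ac R) f2 ->
     ole (Ac R) f1 f2 ->
     forall f3 : testfun R -> R, elt (Ac R) f3 ->
       join (Ac R) f1 (meet (Ac R) f2 f3) =
       meet (Ac R) f2 (join (Ac R) f1 f3)) /\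
  (* (i) *)
  (forall F1 F2 : \bar R * \bar R -> R, continuous F1 -> continuous F2 ->
     (ole (Ac R) (d12 F1) (d12 F2) <->
      forall x y : \bar R,
        F1 (-oo%E, -oo%E) + F1 (x, y) - F1 (-oo%E, y) - F1 (x, -oo%E) <=
        F2 (-oo%E, -oo%E) + F2 (x, y) - F2 (-oo%E, y) - F2 (x, -oo%E))).
Proof.
have bij := d12_bij R.
have le_iso := @Ac_le_d12 R.
have lin := @d12_Bc_lin R.
have nrm := @alexiewicz_d12 R.
have lat := Bc_banach_lattice R.
have surj f : elt (Ac R) f -> exists2 F, Bc_set F & d12 F = f.
  by move=> [_ [F BF ->]]; exists F.
have joinT := iso_join bij le_iso lat.
have meetT := iso_meet bij le_iso lat.
have labsT := iso_labs bij le_iso lin lat.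
have lposT := iso_lpos bij le_iso lin lat.
have lnegT := iso_lneg bij le_iso lin lat.
have eltT F : Bc_set F -> elt (Ac R) (d12 F).
  by move=> BF; have [h _ _] := bij; exact: h.
split; first exact: lat.
split.
  split; first exact: iso_banach_lattice bij le_iso lin nrm lat.
  exact: iso_banach_lattice_iso bij le_iso lin nrm lat.
split.
  split; first exact: Bc_no_order_unit.
  by move=> /(iso_order_unit bij le_iso lin lat); exact: Bc_no_order_unit.
split.
  move=> F F1 F2 BF BF1 BF2.
  by split; [exact: joinT|exact: meetT|rewrite labsT|exact: lposT|exact: lnegT].
split.
  move=> f F _ [BF <-].
  rewrite -(labsT F BF) -(lposT F BF) -(lnegT F BF).
  have Babs := Bc_labs BF; have Bpos := Bc_lpos BF; have Bneg := Bc_lneg BF.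
  split.
  - by split; [exact: eltT|split].
  - by move=> x y; rewrite /Ac_int !primitive_d12// Bc_labsE.
  - by rewrite /= !nrm// supnorm_labs.
  - by rewrite /= !nrm//; exact: supnorm_lpos.
  - by rewrite /= !nrm//; exact: supnorm_lneg.
split.
  move=> f F _ [BF <-].
  rewrite -(lposT F BF) -(lnegT F BF).
  have Bpos := Bc_lpos BF; have Bneg := Bc_lneg BF.
  split.
  - by split; [exact: eltT|split].
  - by split; [exact: eltT|split].
  - by rewrite -(d12B Bpos.1 Bneg.1) -Bc_jordan.
  - move=> g bg; apply: int_prodB; last exact: bg.
    + by rewrite (primitive_d12 Bpos); exact: Bpos.1.
    + by rewrite (primitive_d12 Bneg); exact: Bneg.1.
    + by rewrite (primitive_d12 BF) (primitive_d12 Bpos) (primitive_d12 Bneg); exact: Bc_jordan.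
split.
  move=> _ _ _ /surj[F1 B1 <-] /surj[F2 B2 <-] /surj[F3 B3 <-].
  have Bj F G : Bc_set F -> Bc_set G -> Bc_set (join (Bc R) F G).
    by move=> BF BG; rewrite Bc_joinE//; exact: Bc_max.
  have Bm F G : Bc_set F -> Bc_set G -> Bc_set (meet (Bc R) F G).
    by move=> BF BG; rewrite Bc_meetE//; exact: Bc_min.
  split.
    rewrite -(joinT _ _ B2 B3) -(meetT _ _ B1 (Bj _ _ B2 B3)) -!meetT//.
    by rewrite -joinT ?Bc_meet_join//; exact: Bm.
  rewrite -(meetT _ _ B2 B3) -(joinT _ _ B1 (Bm _ _ B2 B3)) -!joinT//.
  by rewrite -meetT ?Bc_join_meet//; exact: Bj.
split.
  move=> _ _ /surj[F1 B1 <-] /surj[F2 B2 <-] /(le_iso _ _ B1 B2) F12 _ /surj[F3 B3 <-].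
  rewrite -meetT// -!joinT// -?meetT//.
  - by rewrite Bc_modular.
  - by rewrite Bc_joinE//; exact: Bc_max.
  - by rewrite Bc_meetE//; exact: Bc_min.
move=> F1 F2 c1 c2; rewrite -(d12_edge_normal c1) -(d12_edge_normal c2) /=.
rewrite -(le_iso _ _ (Bc_edge_normal c1) (Bc_edge_normal c2)).
by split=> [h x y|h [x y]]; [exact: (h (x, y))|exact: h].
Qed.
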